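(* Let $u,v:\mathbb{C}\to\mathbb{R}$ be harmonic functions and let $f=u+iv:\mathbb{C}\to\mathbb{C}$, with range $\mathcal{R}_f=f(\mathbb{C})$. If the set of asymptotic directions $\mathcal{D}(\mathcal{R}_f)$ contains no pair of antipodal points (i.e. there is no $\zeta\in\partial\mathbb{D}$ with both $\zeta$ and $-\zeta$ in $\mathcal{D}(\mathcal{R}_f)$), then $f$ is constant.
   Context: $\mathbb{D}$ is the open unit disc and $\partial\mathbb{D}=\{e^{i\theta}:\theta\in\mathbb{R}\}$ the unit circle. For a set $\mathcal{R}\subset\mathbb{C}$, a point $e^{i\theta}\in\partial\mathbb{D}$ is an asymptotic direction of $\mathcal{R}$ if there exist points $w_n\in\mathcal{R}$ and positive numbers $\varepsilon_n\to 0$ with $\varepsilon_n w_n\to e^{i\theta}$; $\mathcal{D}(\mathcal{R})$ denotes the set of asymptotic directions of $\mathcal{R}$. A harmonic map $f=u+iv$ is just a pair of real harmonic functions on $\mathbb{C}$ (no univalence assumed). *)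

(* Defs.v *)
From Stdlib Require Import Reals.
From Coquelicot Require Import Coquelicot.
Open Scope R_scope.

Definition dx (u : R -> R -> R) : R -> R -> R :=
  fun x y => Derive (fun t => u t y) x.
Definition dy (u : R -> R -> R) : R -> R -> R :=
  fun x y => Derive (fun t => u x t) y.

Definition cont2 (g : R -> R -> R) (x y : R) : Prop :=
  continuous (fun p : R * R => g (fst p) (snd p)) (x, y).

Definition harmonic (u : R -> R -> R) : Prop :=
  forall x y : R,
    ex_derive (fun t => u t y) x /\ ex_derive (fun t => u x t) y /\
    ex_derive (fun t => dx u t y) x /\ ex_derive (fun t => dx u x t) y /\
    ex_derive (fun t => dy u t y) x /\ ex_derive (fun t => dy u x t) y /\
    cont2 u x y /\ cont2 (dx u) x y /\ cont2 (dy u) x y /\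
    cont2 (dx (dx u)) x y /\ cont2 (dy (dx u)) x y /\
    cont2 (dx (dy u)) x y /\ cont2 (dy (dy u)) x y /\
    dx (dx u) x y + dy (dy u) x y = 0.

Definition asymptotic_direction (S : R * R -> Prop) (zeta : R * R) : Prop :=
  exists (w : nat -> R * R) (eps : nat -> R),
    (forall n, S (w n)) /\ (forall n, 0 < eps n) /\
    is_lim_seq eps 0 /\
    is_lim_seq (fun n => eps n * fst (w n)) (fst zeta) /\
    is_lim_seq (fun n => eps n * snd (w n)) (snd zeta).

Definition on_unit_circle (zeta : R * R) : Prop :=
  fst zeta ^ 2 + snd zeta ^ 2 = 1.

Definition range_f (u v : R -> R -> R) : R * R -> Prop :=
  fun w => exists x y : R, w = (u x y, v x y).

(* Main.v *)
(* Compactness of the circle turns the hypothesis into a uniform statement: two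
   values of f of modulus > rho are never nearly antipodal.  Hence, on a disc where
   |f| > rho, the argument of f varies by less than pi, and Harnack's inequality
   holds for |f|.  If f were unbounded, a Lewis-type selection would give discs
   D(z, 2d) with |f(z)| <= rho on which |f|/g is bounded by a fixed constant, while
   |f|/g > 1/2 somewhere on D(z, d), with g arbitrarily large.  Expand the rescaled
   map as sum_j r^j P_j(theta), with P_j(theta + pi/j) = - P_j(theta).  The constant
   term is tiny; if P_j is the first term that is not, it dominates at a small radius
   and f takes nearly antipodal large values at theta and theta + pi/j.  So all the
   terms are small, a contradiction.  Thus f is bounded, and Liouville applies. *)

Require Import Defs.
From Stdlib Require Import Reals.
From Coquelicot Require Import Coquelicot.
From Stdlib Require Import Lra Lia Psatz Classical IndefiniteDescription.
Open Scope R_scope.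

(** * Maximum principle *)

(** Separation is compatible with rescaling: dividing the map by [g] keeps the angular gap [c] and
    replaces the threshold [rho] by [rho / g]. The Harnack constant [K] depends only on [c], so the
    rescaled maps share the bound [K ^ 16], and the tolerance required of the threshold and of the
    value at the centre is fixed before [g] is chosen. The obstacle is that the smallness of the
    modes must hold with one tolerance for all rescaled maps at once. No limit map is extracted from
    a sequence of rescalings. Instead the truncation error of the expansion is bounded in terms of
    the bound on the map alone, so that finitely many modes matter, and these are handled by
    induction with explicit tolerances. The expansion, the Harnack inequality and Liouville's
    theorem all come from the Poisson formula, which is itself deduced from the maximum
    principle. *)

Lemma second_derivative_test (h h1 : R -> R) (x0 l d : R) :
  0 < d -> (forall t, is_derive h t (h1 t)) -> is_derive h1 x0 l ->
  (forall t, Rabs (t - x0) < d -> h t <= h x0) -> l <= 0.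
Proof.
intros Hd Hh Hl Hmax.
destruct (Rle_or_lt l 0) as [|Hpos]; [assumption|exfalso].
assert (H0 : h1 x0 = 0).
{ assert (pr : derivable_pt h x0) by (exists (h1 x0); apply is_derive_Reals, Hh).
  rewrite <- (deriv_maximum h (x0 - d) (x0 + d) x0 pr); try lra.
  - symmetry. apply derive_pt_eq_0, is_derive_Reals, Hh.
  - intros x H1 H2. apply Hmax. apply Rabs_def1; lra. }
apply is_derive_Reals in Hl.
destruct (Hl (l / 2)) as [e He]; [lra|].
pose (t := x0 + Rmin d e / 2).
assert (Hm : 0 < Rmin d e) by (apply Rmin_pos; [assumption|apply cond_pos]).
assert (Hmd := Rmin_l d e). assert (Hme := Rmin_r d e).
destruct (MVT_cor2 h h1 x0 t) as [c [Hc Hcc]]; [unfold t; lra| |].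
{ intros; apply is_derive_Reals, Hh. }
assert (Ht : h t <= h x0) by (apply Hmax; unfold t; rewrite Rabs_pos_eq; lra).
specialize (He (c - x0)). replace (x0 + (c - x0)) with c in He by ring.
assert (Hq : Rabs ((h1 c - h1 x0) / (c - x0) - l) < l / 2).
{ apply He; [lra|]. rewrite Rabs_pos_eq by lra. unfold t in Hcc; lra. }
apply Rabs_def2 in Hq. rewrite H0, Rminus_0_r in Hq.
assert (0 < h1 c).
{ replace (h1 c) with (h1 c / (c - x0) * (c - x0)) by (field; lra).
  apply Rmult_lt_0_compat; lra. }
assert (0 < h1 c * (t - x0)) by (apply Rmult_lt_0_compat; lra).
lra.
Qed.

(** Maximise on each vertical segment, then over the segments. The chosen maximiser [Y x] may jump
    with [x], but uniform continuity makes the maximal value [f x (Y x)] continuous. *)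
Lemma extreme_value_rectangle (f : R -> R -> R) (a b c d : R) :
  a <= b -> c <= d -> (forall x y, continuity_2d_pt f x y) ->
  exists x0 y0, a <= x0 <= b /\ c <= y0 <= d /\
    forall x y, a <= x <= b -> c <= y <= d -> f x y <= f x0 y0.
Proof.
intros Hab Hcd Hf.
assert (Hy : forall x, exists y, c <= y <= d /\ forall y', c <= y' <= d -> f x y' <= f x y).
{ intros x. destruct (continuity_ab_maj (f x) c d Hcd) as [y [H1 H2]].
  - intros y _ e He. destruct (Hf x y (mkposreal e He)) as [k Hk].
    exists k; split; [apply cond_pos|]. intros z [_ Hz]. apply Hk; [|exact Hz].
    rewrite Rminus_diag, Rabs_R0. apply cond_pos.
  - exists y; split; auto. }
apply functional_choice in Hy. destruct Hy as [Y HY].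
destruct (continuity_ab_maj (fun x => f x (Y x)) a b Hab) as [x0 [H1 H2]].
- intros x Hx e He.
  (* The margin 1 on each side leaves room for points [z] near an endpoint but outside the
     interval. *)
  destruct (uniform_continuity_2d f (a - 1) (b + 1) c d (fun x y _ _ => Hf x y) (mkposreal e He)) as [k Hk].
  exists (Rmin k 1). split; [apply Rmin_pos; [apply cond_pos|lra]|].
  intros z [_ Hz]. simpl in *. unfold R_dist in *.
  assert (Hz1 := Rmin_l k 1). assert (Hz2 := Rmin_r k 1).
  assert (Hzx : Rabs (z - x) < 1) by lra. apply Rabs_def2 in Hzx.
  destruct (HY x) as [Yx Mx]. destruct (HY z) as [Yz Mz].
  assert (K : forall y, c <= y <= d -> Rabs (f z y - f x y) < e).
  { intros y Hyy. apply Hk; try lra. rewrite Rminus_diag, Rabs_R0. apply cond_pos. }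
  assert (K1 := K _ Yx). assert (K2 := K _ Yz).
  assert (M1 := Mx _ Yz). assert (M2 := Mz _ Yx).
  apply Rabs_def2 in K1. apply Rabs_def2 in K2. apply Rabs_def1; lra.
- exists x0, (Y x0). split; [assumption|]. split; [apply HY|].
  intros x y Hx Hyy. apply Rle_trans with (f x (Y x)); [apply HY; assumption|apply H1; assumption].
Qed.

(** Keeping the angle in a compact interval presents the disc as the image of a rectangle, and later
    lets sequences of directions be handled by Bolzano-Weierstrass. *)
Lemma polar_coordinates (x y : R) :
  exists r t, 0 <= r /\ r ^ 2 = x ^ 2 + y ^ 2 /\ - PI <= t <= PI /\ x = r * cos t /\ y = r * sin t.
Proof.
set (r := sqrt (x ^ 2 + y ^ 2)).
assert (Hr2 : r * r = x ^ 2 + y ^ 2) by (apply sqrt_sqrt; nra).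
assert (Hr0 : 0 <= r) by apply sqrt_pos.
exists r. clearbody r.
enough (H : exists t, - PI <= t <= PI /\ x = r * cos t /\ y = r * sin t).
{ destruct H as [t Ht]. exists t. split; [assumption|]. split; [nra|assumption]. }
assert (HPI := PI_RGT_0).
destruct (Req_dec r 0) as [H0|H0].
- exists 0. rewrite H0 in *. split; [lra|]. split; nra.
- assert (Hx : -1 <= x / r <= 1).
  { split.
    - apply Rmult_le_reg_r with r; [lra|]. unfold Rdiv. rewrite Rmult_assoc, Rinv_l by lra. nra.
    - apply Rmult_le_reg_r with r; [lra|]. unfold Rdiv. rewrite Rmult_assoc, Rinv_l by lra. nra. }
  assert (Hb := acos_bound (x / r)).
  assert (Hc := cos_acos _ Hx).
  assert (Hs := sin_acos _ Hx).
  assert (Hsq : r * sqrt (1 - Rsqr (x / r)) = Rabs y).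
  { rewrite <- (sqrt_Rsqr_abs y). rewrite <- (sqrt_Rsqr r) at 1 by assumption.
    rewrite <- sqrt_mult; [f_equal|apply Rle_0_sqr|].
    - unfold Rsqr. replace (r * r * (1 - x / r * (x / r))) with (r * r - x * x) by (field; lra). nra.
    - unfold Rsqr. nra. }
  destruct (Rle_or_lt 0 y) as [Hy|Hy].
  + exists (acos (x / r)). rewrite Hc, Hs, Hsq, Rabs_pos_eq by assumption.
    split; [lra|]. split; [field; lra|reflexivity].
  + exists (- acos (x / r)). rewrite cos_neg, sin_neg, Hc, Hs.
    rewrite Ropp_mult_distr_r_reverse, Hsq, Rabs_left by assumption.
    split; [lra|]. split; [field; lra|ring].
Qed.

Lemma continuity_2d_cont2 (f : R -> R -> R) x y : continuity_2d_pt f x y <-> cont2 f x y.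
Proof. apply continuity_2d_pt_filterlim. Qed.

Lemma cont2_comp (f a b : R -> R -> R) (x y : R) :
  cont2 f (a x y) (b x y) -> cont2 a x y -> cont2 b x y ->
  cont2 (fun s t => f (a s t) (b s t)) x y.
Proof.
intros Hf Ha Hb. unfold cont2 in *.
apply (continuous_comp_2 (fun p : R * R => a (fst p) (snd p)) (fun p => b (fst p) (snd p)) f); assumption.
Qed.

Lemma cont2_polar (w : R -> R -> R) :
  (forall x y, cont2 w x y) -> forall r t, cont2 (fun r t => w (r * cos t) (r * sin t)) r t.
Proof.
intros Hw r t.
apply (cont2_comp w (fun r t => r * cos t) (fun r t => r * sin t)); [apply Hw| |];
  unfold cont2; simpl; refine (continuous_mult _ _ _ _ _); try apply continuous_fst;
  [apply (continuous_comp (fun p : R * R => snd p) cos)|apply (continuous_comp (fun p : R * R => snd p) sin)];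
  try apply continuous_snd; apply continuity_pt_filterlim; [apply continuity_cos|apply continuity_sin].
Qed.

Lemma extreme_value_disc (w : R -> R -> R) :
  (forall x y, cont2 w x y) ->
  exists x0 y0, x0 ^ 2 + y0 ^ 2 <= 1 /\ forall x y, x ^ 2 + y ^ 2 <= 1 -> w x y <= w x0 y0.
Proof.
intros Hw. assert (HPI := PI_RGT_0).
destruct (extreme_value_rectangle (fun r t => w (r * cos t) (r * sin t)) 0 1 (- PI) PI)
  as (r0 & t0 & Hr & _ & Hmax); [lra|lra| |].
- intros r t. apply continuity_2d_cont2, cont2_polar, Hw.
- exists (r0 * cos t0), (r0 * sin t0). split.
  + assert (H := sin2_cos2 t0). unfold Rsqr in H. nra.
  + intros x y Hxy. destruct (polar_coordinates x y) as (r & t & Hr1 & Hr2 & Ht & -> & ->).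
    apply Hmax; [|assumption]. split; nra.
Qed.

(* The part of harmonicity that the maximum principle uses; unlike [harmonic], it passes to sums and affine changes of variables without computing [Derive]. *)
Definition weakly_harmonic (w : R -> R -> R) : Prop :=
  (forall x y, cont2 w x y) /\
  exists a b a' b' : R -> R -> R, forall x y,
    is_derive (fun t => w t y) x (a x y) /\ is_derive (fun t => w x t) y (b x y) /\
    is_derive (fun t => a t y) x (a' x y) /\ is_derive (fun t => b x t) y (b' x y) /\
    a' x y + b' x y = 0.

Lemma harmonic_weakly (u : R -> R -> R) : harmonic u -> weakly_harmonic u.
Proof.
intros H. split; [intros x y; destruct (H x y) as (_ & _ & _ & _ & _ & _ & Hc & _); exact Hc|].
exists (dx u), (dy u), (dx (dx u)), (dy (dy u)). intros x y.
destruct (H x y) as (H1 & H2 & H3 & _ & _ & H4 & _ & _ & _ & _ & _ & _ & _ & H5).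
split; [|split; [|split; [|split]]]; try assumption; apply Derive_correct; assumption.
Qed.

Lemma weakly_harmonic_lin (u v : R -> R -> R) (a b : R) :
  weakly_harmonic u -> weakly_harmonic v -> weakly_harmonic (fun x y => a * u x y + b * v x y).
Proof.
intros [Cu (u1 & u2 & u3 & u4 & Hu)] [Cv (v1 & v2 & v3 & v4 & Hv)]. split.
- intros x y. unfold cont2. refine (continuous_plus _ _ _ _ _); refine (continuous_mult _ _ _ _ _);
  try apply continuous_const; [apply Cu|apply Cv].
- exists (fun x y => a * u1 x y + b * v1 x y), (fun x y => a * u2 x y + b * v2 x y),
    (fun x y => a * u3 x y + b * v3 x y), (fun x y => a * u4 x y + b * v4 x y).
  intros x y. destruct (Hu x y) as (A1 & A2 & A3 & A4 & A5). destruct (Hv x y) as (B1 & B2 & B3 & B4 & B5).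
  split; [|split; [|split; [|split]]]; try (refine (is_derive_plus _ _ _ _ _ _ _); refine (is_derive_scal _ _ _ _ _); assumption).
  replace (a * u3 x y + b * v3 x y + (a * u4 x y + b * v4 x y))
    with (a * (u3 x y + u4 x y) + b * (v3 x y + v4 x y)) by ring.
  rewrite A5, B5; ring.
Qed.

Lemma is_derive_affine (f : R -> R) (c s x l : R) :
  is_derive f (c + s * x) l -> is_derive (fun t => f (c + s * t)) x (s * l).
Proof.
intros H. refine (is_derive_comp f (fun t => c + s * t) _ _ _ _ _); [exact H|].
auto_derive; [trivial|ring].
Qed.

Lemma weakly_harmonic_affine (u : R -> R -> R) (x0 y0 s : R) :
  weakly_harmonic u -> weakly_harmonic (fun x y => u (x0 + s * x) (y0 + s * y)).
Proof.
intros [Cu (u1 & u2 & u3 & u4 & Hu)]. split.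
- intros x y. apply (cont2_comp u (fun x y => x0 + s * x) (fun x y => y0 + s * y)); [apply Cu| |];
  unfold cont2; simpl; refine (continuous_plus _ _ _ _ _); try apply continuous_const;
  refine (continuous_mult _ _ _ _ _); try apply continuous_const; [apply continuous_fst|apply continuous_snd].
- exists (fun x y => s * u1 (x0 + s * x) (y0 + s * y)), (fun x y => s * u2 (x0 + s * x) (y0 + s * y)),
    (fun x y => s * (s * u3 (x0 + s * x) (y0 + s * y))), (fun x y => s * (s * u4 (x0 + s * x) (y0 + s * y))).
  intros x y. destruct (Hu (x0 + s * x) (y0 + s * y)) as (A1 & A2 & A3 & A4 & A5).
  split; [|split; [|split; [|split]]].
  + apply (is_derive_affine (fun t => u t (y0 + s * y))), A1.
  + apply (is_derive_affine (fun t => u (x0 + s * x) t)), A2.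
  + refine (is_derive_scal _ _ _ _ _). apply (is_derive_affine (fun t => u1 t (y0 + s * y))), A3.
  + refine (is_derive_scal _ _ _ _ _). apply (is_derive_affine (fun t => u2 (x0 + s * x) t)), A4.
  + replace (s * (s * u3 (x0 + s * x) (y0 + s * y)) + s * (s * u4 (x0 + s * x) (y0 + s * y)))
      with (s * s * (u3 (x0 + s * x) (y0 + s * y) + u4 (x0 + s * x) (y0 + s * y))) by ring.
    rewrite A5; ring.
Qed.

(** Adding [e * (x ^ 2 + y ^ 2)] makes the Laplacian equal to [4 * e > 0], which rules out an
    interior maximum. As [e] is half the supposed excess over [m], the perturbed function is at most
    [m + e] on the circle and at least [m + 2 * e] at the offending point, so its maximum is not on
    the circle either. *)
Lemma maximum_principle (w : R -> R -> R) (m : R) :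
  weakly_harmonic w -> (forall t, w (cos t) (sin t) <= m) ->
  forall x y, x ^ 2 + y ^ 2 <= 1 -> w x y <= m.
Proof.
intros [Cw (a & b & a' & b' & Hw)] Hm x1 y1 H1.
destruct (Rle_or_lt (w x1 y1) m) as [|Hlt]; [assumption|exfalso].
pose (e := (w x1 y1 - m) / 2).
assert (He : 0 < e) by (unfold e; lra).
pose (W := fun x y => w x y + e * (x ^ 2 + y ^ 2)).
destruct (extreme_value_disc W) as (x0 & y0 & H0 & Hmax).
{ intros x y. unfold W, cont2. refine (continuous_plus _ _ _ _ _); [apply Cw|].
  refine (continuous_mult _ _ _ _ _); [apply continuous_const|]. simpl.
  refine (continuous_plus _ _ _ _ _); refine (continuous_mult _ _ _ _ _); try apply continuous_fst; try apply continuous_snd;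
  refine (continuous_mult _ _ _ _ _); try apply continuous_fst; try apply continuous_snd; apply continuous_const. }
assert (Hin : x0 ^ 2 + y0 ^ 2 < 1).
{ destruct (Rle_lt_or_eq_dec _ _ H0) as [|Heq]; [assumption|exfalso].
  assert (HW := Hmax x1 y1 H1). unfold W in HW. rewrite Heq in HW.
  destruct (polar_coordinates x0 y0) as (r & t & Hr & Hr2 & _ & Hx & Hy).
  assert (Hr1 : r = 1) by nra. rewrite Hr1, Rmult_1_l in Hx, Hy.
  assert (Ht := Hm t). rewrite <- Hx, <- Hy in Ht. unfold e in *. nra. }
assert (Hnear : exists d, 0 < d /\ forall h, Rabs h < d ->
   (x0 + h) ^ 2 + y0 ^ 2 <= 1 /\ x0 ^ 2 + (y0 + h) ^ 2 <= 1).
{ pose (d := (1 - (x0 ^ 2 + y0 ^ 2)) / 4). exists d.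
  assert (Hd : 0 < d <= 1 / 4) by (unfold d; nra).
  split; [lra|]. intros h Hh. apply Rabs_def2 in Hh.
  assert (Hs : x0 ^ 2 + y0 ^ 2 = 1 - 4 * d) by (unfold d; field). clearbody d.
  assert (-1 <= x0 <= 1) by nra. assert (-1 <= y0 <= 1) by nra.
  assert (h * h <= d) by nra. assert (x0 * h <= d) by nra. assert (y0 * h <= d) by nra.
  split; lra. }
destruct Hnear as (d & Hd & Hnear).
destruct (Hw x0 y0) as (_ & _ & Ha & Hb & Hsum).
assert (K1 : a' x0 y0 + 2 * e <= 0).
{ apply (second_derivative_test (fun t => W t y0) (fun t => a t y0 + e * (2 * t)) x0 _ d Hd).
  - intros t. refine (is_derive_plus _ _ _ _ _ _ _); [apply Hw|]. auto_derive; [trivial|ring].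
  - refine (is_derive_plus _ _ _ _ _ _ _); [exact Ha|]. auto_derive; [trivial|ring].
  - intros t Ht. apply Hmax. replace t with (x0 + (t - x0)) by ring. apply Hnear, Ht. }
assert (K2 : b' x0 y0 + 2 * e <= 0).
{ apply (second_derivative_test (fun t => W x0 t) (fun t => b x0 t + e * (2 * t)) y0 _ d Hd).
  - intros t. refine (is_derive_plus _ _ _ _ _ _ _); [apply Hw|]. auto_derive; [trivial|ring].
  - refine (is_derive_plus _ _ _ _ _ _ _); [exact Hb|]. auto_derive; [trivial|ring].
  - intros t Ht. apply Hmax. replace t with (y0 + (t - y0)) by ring. apply Hnear, Ht. }
lra.
Qed.

Lemma maximum_principle_abs (w : R -> R -> R) (m : R) :
  weakly_harmonic w -> (forall t, Rabs (w (cos t) (sin t)) <= m) ->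
  forall x y, x ^ 2 + y ^ 2 <= 1 -> Rabs (w x y) <= m.
Proof.
intros Hw Hm x y Hxy. apply Rabs_le. split.
- assert (H := maximum_principle _ m (weakly_harmonic_lin w w (-1) 0 Hw Hw)).
  assert (-1 * w x y + 0 * w x y <= m); [|lra].
  apply H; [|assumption]. intros t. assert (Ht := Hm t). apply Rabs_le_between in Ht. lra.
- apply (maximum_principle w m Hw); [|assumption].
  intros t. assert (Ht := Hm t). apply Rabs_le_between in Ht. lra.
Qed.

Lemma weakly_harmonic_ext (u v : R -> R -> R) :
  (forall x y, u x y = v x y) -> weakly_harmonic u -> weakly_harmonic v.
Proof.
intros E [Cu (a & b & a' & b' & H)]. split.
- intros x y. apply (continuous_ext (fun p : R * R => u (fst p) (snd p))); [intros; apply E|apply Cu].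
- exists a, b, a', b'. intros x y. destruct (H x y) as (H1 & H2 & H3 & H4 & H5).
  split; [|split; [|split; [|split]]]; try assumption.
  + apply (is_derive_ext (fun t => u t y)); [intros; apply E|assumption].
  + apply (is_derive_ext (fun t => u x t)); [intros; apply E|assumption].
Qed.

(** * Poisson formula *)

Definition avg (f : R -> R) : R := RInt f 0 (2 * PI) / (2 * PI).
Definition continuous_fun (f : R -> R) : Prop := forall t, continuous f t.

Lemma continuous_fun_mult f g : continuous_fun f -> continuous_fun g -> continuous_fun (fun t => f t * g t).
Proof. intros Hf Hg t. refine (continuous_mult _ _ _ _ _); [apply Hf|apply Hg]. Qed.

Lemma continuous_fun_plus f g : continuous_fun f -> continuous_fun g -> continuous_fun (fun t => f t + g t).
Proof. intros Hf Hg t. refine (continuous_plus _ _ _ _ _); [apply Hf|apply Hg]. Qed.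

Lemma continuous_fun_const c : continuous_fun (fun _ => c).
Proof. intros t. apply continuous_const. Qed.

Lemma ex_RInt_continuous_fun f a b : continuous_fun f -> ex_RInt f a b.
Proof. intros Hf. apply (ex_RInt_continuous (V := R_CompleteNormedModule)). intros; apply Hf. Qed.

Lemma avg_ext f g : (forall t, f t = g t) -> avg f = avg g.
Proof. intros H. unfold avg. rewrite (RInt_ext f g); auto. Qed.

Lemma avg_plus f g : continuous_fun f -> continuous_fun g -> avg (fun t => f t + g t) = avg f + avg g.
Proof.
intros Hf Hg. unfold avg.
assert (H : RInt (fun t => f t + g t) 0 (2 * PI) = RInt f 0 (2 * PI) + RInt g 0 (2 * PI))
  by (apply (RInt_plus f g 0 (2 * PI)); apply ex_RInt_continuous_fun; assumption).
rewrite H. field. apply PI_neq0.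
Qed.

Lemma avg_scal c f : continuous_fun f -> avg (fun t => c * f t) = c * avg f.
Proof.
intros Hf. unfold avg.
assert (H : RInt (fun t => c * f t) 0 (2 * PI) = c * RInt f 0 (2 * PI))
  by (apply (RInt_scal f 0 (2 * PI) c); apply ex_RInt_continuous_fun; assumption).
rewrite H. field. apply PI_neq0.
Qed.

Lemma avg_const c : avg (fun _ => c) = c.
Proof.
unfold avg. rewrite RInt_const. unfold scal; simpl; unfold mult; simpl. field. apply PI_neq0.
Qed.

Lemma avg_le f g : continuous_fun f -> continuous_fun g -> (forall t, f t <= g t) -> avg f <= avg g.
Proof.
intros Hf Hg H. unfold avg. assert (HPI := PI_RGT_0).
apply Rmult_le_compat_r; [left; apply Rinv_0_lt_compat; lra|].
apply RInt_le; [lra| | |auto]; apply ex_RInt_continuous_fun; assumption.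
Qed.

Lemma avg_abs f g : continuous_fun f -> continuous_fun g ->
  (forall t, Rabs (f t) <= g t) -> Rabs (avg f) <= avg g.
Proof.
intros Hf Hg H. apply Rabs_le. split.
- replace (- avg g) with (avg (fun t => -1 * g t)) by (rewrite avg_scal by assumption; ring).
  apply avg_le; try assumption.
  + apply continuous_fun_mult; [apply continuous_fun_const|assumption].
  + intros t. assert (Ht := H t). apply Rabs_le_between in Ht. lra.
- apply avg_le; try assumption. intros t. assert (Ht := H t). apply Rabs_le_between in Ht. lra.
Qed.

(** The 2 merges the frequencies [j] and [- j] of the Poisson kernel; frequency 0 is its own
    opposite. *)
Definition cf (j : nat) : R := match j with O => 1 | S _ => 2 end.
Definition mode (j : nat) (s : R) : R := cf j * cos (INR j * s).
Definition poisson_partial (r : R) (N : nat) (s : R) : R := sum_f_R0 (fun j => r ^ j * mode j s) N.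
Definition poisson (r s : R) : R := (1 - r ^ 2) / (1 - 2 * r * cos s + r ^ 2).

(** Multiplication by the denominator of the kernel telescopes the sum, because [2 * cos s * cos (n
    * s) = cos ((n + 1) * s) + cos ((n - 1) * s)]. What remains is the numerator of [poisson] and
    two end terms, which give the truncation error. *)
Lemma poisson_partial_closed (r : R) (N : nat) (s : R) :
  (1 - 2 * r * cos s + r ^ 2) * poisson_partial r N s
  = 1 - r ^ 2 - 2 * r ^ (N + 1) * cos (INR (N + 1) * s) + 2 * r ^ (N + 2) * cos (INR N * s).
Proof.
unfold poisson_partial. induction N as [|N IH].
- simpl. unfold mode, cf. simpl. rewrite (Rmult_0_l s), (Rmult_1_l s), cos_0. ring.
- simpl sum_f_R0. rewrite Rmult_plus_distr_l, IH. unfold mode, cf.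
  assert (H : 2 * cos s * cos (INR (S N) * s) = cos (INR (S N + 1) * s) + cos (INR N * s)).
  { replace (INR (S N + 1) * s) with (INR (S N) * s + s) by (rewrite plus_INR; simpl (INR 1); ring).
    replace (INR N * s) with (INR (S N) * s - s) by (rewrite S_INR; ring).
    rewrite cos_plus, cos_minus. ring. }
  replace (S N) with (N + 1)%nat in * by lia.
  replace (N + 1 + 1)%nat with (N + 2)%nat in * by lia.
  replace (N + 1 + 2)%nat with (N + 3)%nat in * by lia.
  replace (cos (INR (N + 2) * s)) with (2 * cos s * cos (INR (N + 1) * s) - cos (INR N * s)) by lra.
  rewrite !pow_add. ring.
Qed.

Lemma poisson_denominator (r s : R) : 0 <= r < 1 -> (1 - r) ^ 2 <= 1 - 2 * r * cos s + r ^ 2.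
Proof. intros Hr. assert (H := COS_bound s). nra. Qed.

Lemma poisson_denominator_pos (r s : R) : 0 <= r < 1 -> 0 < 1 - 2 * r * cos s + r ^ 2.
Proof. intros Hr. assert (H := poisson_denominator r s Hr). nra. Qed.

Lemma poisson_truncation (r : R) (N : nat) (s : R) :
  0 <= r < 1 -> Rabs (poisson r s - poisson_partial r N s) <= 4 * r ^ (N + 1) / (1 - r) ^ 2.
Proof.
intros Hr. assert (HD := poisson_denominator r s Hr). assert (HP := poisson_denominator_pos r s Hr).
assert (H1 : 0 < (1 - r) ^ 2) by (apply pow_lt; lra).
replace (poisson r s - poisson_partial r N s)
  with ((2 * r ^ (N + 1) * cos (INR (N + 1) * s) - 2 * r ^ (N + 2) * cos (INR N * s)) / (1 - 2 * r * cos s + r ^ 2)).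
2:{ apply Rmult_eq_reg_l with (1 - 2 * r * cos s + r ^ 2); [|lra].
    rewrite Rmult_minus_distr_l, poisson_partial_closed. unfold poisson. field. lra. }
unfold Rdiv. rewrite Rabs_mult. rewrite (Rabs_pos_eq (/ _)) by (left; apply Rinv_0_lt_compat; assumption).
apply Rmult_le_compat; [apply Rabs_pos|left; apply Rinv_0_lt_compat; assumption| |apply Rinv_le_contravar; assumption].
replace (r ^ (N + 2)) with (r ^ (N + 1) * r) by (rewrite !pow_add; ring).
assert (H2 := COS_bound (INR (N + 1) * s)). assert (H3 := COS_bound (INR N * s)).
assert (H4 : 0 <= r ^ (N + 1)) by (apply pow_le; lra).
set (q := r ^ (N + 1)) in *. set (c1 := cos (INR (N + 1) * s)) in *. set (c2 := cos (INR N * s)) in *.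
replace (2 * q * c1 - 2 * (q * r) * c2) with (2 * q * (c1 - r * c2)) by ring.
rewrite Rabs_mult, (Rabs_pos_eq (2 * q)) by lra.
assert (-1 <= r * c2 <= 1) by nra.
assert (Rabs (c1 - r * c2) <= 2) by (apply Rabs_le; lra). nra.
Qed.

Lemma poisson_pos (r s : R) : 0 <= r < 1 -> 0 <= poisson r s.
Proof.
intros Hr. unfold poisson. apply Rmult_le_pos; [nra|].
left. apply Rinv_0_lt_compat, poisson_denominator_pos, Hr.
Qed.

Lemma continuous_fun_poisson r th : 0 <= r < 1 -> continuous_fun (fun t => poisson r (th - t)).
Proof.
intros Hr t. apply (ex_derive_continuous (K := R_AbsRing) (V := R_NormedModule)).
unfold poisson. auto_derive.
assert (H := poisson_denominator_pos r (th + - t) Hr). simpl in H. lra.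
Qed.

Lemma continuous_fun_mode j th : continuous_fun (fun t => mode j (th - t)).
Proof.
intros t. apply (ex_derive_continuous (K := R_AbsRing) (V := R_NormedModule)).
unfold mode. auto_derive. trivial.
Qed.

Lemma continuous_fun_partial r N th : continuous_fun (fun t => poisson_partial r N (th - t)).
Proof.
unfold poisson_partial. induction N as [|N IH]; simpl.
- apply continuous_fun_mult; [apply continuous_fun_const|apply continuous_fun_mode].
- apply continuous_fun_plus; [exact IH|].
  apply continuous_fun_mult; [apply continuous_fun_const|apply continuous_fun_mode].
Qed.

Ltac continuity_solver :=
  repeat match goal with
  | |- continuous_fun (fun _ => ?c) => exact (continuous_fun_const c)
  | H : continuous_fun ?f |- continuous_fun ?f => exact H
  | H : continuous_fun ?f |- continuous_fun (fun t => ?f t) => exact H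
  | |- continuous_fun (fun t => poisson ?r (?th - t)) => apply (continuous_fun_poisson r th); lra
  | |- continuous_fun (fun t => poisson_partial ?r ?N (?th - t)) => exact (continuous_fun_partial r N th)
  | |- continuous_fun (fun t => mode ?j (?th - t)) => exact (continuous_fun_mode j th)
  | |- continuous_fun (fun t => @?f t + @?g t) => apply (continuous_fun_plus f g)
  | |- continuous_fun (fun t => @?f t * @?g t) => apply (continuous_fun_mult f g)
  end.

Lemma avg_mode_S j th : avg (fun t => mode (S j) (th - t)) = 0.
Proof.
assert (Hj : INR (S j) <> 0) by (apply not_0_INR; lia).
unfold avg. erewrite is_RInt_unique.
2:{ apply (is_RInt_derive (fun t => - (2 * sin (INR (S j) * (th - t))) / INR (S j))).
  - intros t _. unfold mode, cf. generalize (INR (S j)) Hj. intros c Hc.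
    auto_derive; [trivial|]. unfold Rminus. field. exact Hc.
  - intros t _. apply continuous_fun_mode. }
replace (INR (S j) * (th - 0)) with (INR (S j) * (th - 2 * PI) + 2 * INR (S j) * PI) by ring.
rewrite sin_period. generalize (INR (S j)) Hj. intros c Hc.
unfold minus, plus, opp; simpl. field. split; [exact Hc|apply PI_neq0].
Qed.

Lemma avg_partial r N th : avg (fun t => poisson_partial r N (th - t)) = 1.
Proof.
unfold poisson_partial. induction N as [|N IH].
- simpl. erewrite avg_ext; [apply (avg_const 1)|].
  intros t. unfold mode, cf. simpl. rewrite Rmult_0_l, cos_0. ring.
- simpl sum_f_R0. rewrite avg_plus.
  + rewrite IH, avg_scal, avg_mode_S by apply continuous_fun_mode. ring.
  + apply continuous_fun_partial.
  + apply continuous_fun_mult; [apply continuous_fun_const|apply continuous_fun_mode].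
Qed.

Lemma pow_small (r K e : R) : 0 <= r < 1 -> 0 < e -> exists N, K * r ^ (N + 1) <= e.
Proof.
intros Hr He.
destruct (pow_lt_1_zero r) with (y := e / (Rabs K + 1)) as [N HN].
- rewrite Rabs_pos_eq; lra.
- apply Rdiv_lt_0_compat; [assumption|]. assert (H := Rabs_pos K). lra.
- exists N. assert (H := HN (N + 1)%nat ltac:(lia)).
  assert (HK := Rabs_pos K). assert (HK' := Rle_abs K).
  rewrite Rabs_pos_eq in H by (apply pow_le; lra).
  assert (H0 : 0 <= r ^ (N + 1)) by (apply pow_le; lra).
  apply Rlt_le, Rmult_le_compat_r with (r := Rabs K + 1) in H; [|lra].
  unfold Rdiv in H. rewrite Rmult_assoc, Rinv_l in H by lra. nra.
Qed.

Lemma avg_poisson_truncation g r N th M :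
  continuous_fun g -> (forall t, Rabs (g t) <= M) -> 0 <= r < 1 ->
  Rabs (avg (fun t => poisson r (th - t) * g t) - avg (fun t => poisson_partial r N (th - t) * g t))
  <= M * (4 / (1 - r) ^ 2) * r ^ (N + 1).
Proof.
intros Hg HM Hr.
replace (avg (fun t => poisson r (th - t) * g t) - avg (fun t => poisson_partial r N (th - t) * g t))
  with (avg (fun t => poisson r (th - t) * g t + -1 * (poisson_partial r N (th - t) * g t))).
- rewrite <- (avg_const (M * (4 / (1 - r) ^ 2) * r ^ (N + 1))).
  apply avg_abs; [|apply continuous_fun_const|].
  + apply continuous_fun_plus; [|apply continuous_fun_mult; [apply continuous_fun_const|]];
    apply continuous_fun_mult; try assumption; [apply continuous_fun_poisson; assumption|apply continuous_fun_partial].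
  + intros t. replace (poisson r (th - t) * g t + -1 * (poisson_partial r N (th - t) * g t))
      with (g t * (poisson r (th - t) - poisson_partial r N (th - t))) by ring.
    rewrite Rabs_mult.
    replace (M * (4 / (1 - r) ^ 2) * r ^ (N + 1)) with (M * (4 * r ^ (N + 1) / (1 - r) ^ 2)).
    2:{ field. lra. }
    apply Rmult_le_compat; try apply Rabs_pos; [apply HM|apply poisson_truncation, Hr].
- rewrite avg_plus, avg_scal; [ring| | |].
  + apply continuous_fun_mult; [apply continuous_fun_partial|assumption].
  + apply continuous_fun_mult; [apply continuous_fun_poisson; assumption|assumption].
  + apply continuous_fun_mult; [apply continuous_fun_const|].
    apply continuous_fun_mult; [apply continuous_fun_partial|assumption].
Qed.

Lemma avg_poisson r th : 0 <= r < 1 -> avg (fun t => poisson r (th - t)) = 1.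
Proof.
intros Hr. apply cond_eq. intros e He.
destruct (pow_small r (1 * (4 / (1 - r) ^ 2)) (e / 2) Hr) as [N HN]; [lra|].
assert (H := avg_poisson_truncation (fun _ => 1) r N th 1 (continuous_fun_const 1)
  ltac:(intros; simpl; rewrite Rabs_R1; lra) Hr).
cbv beta in H.
rewrite (avg_ext (fun t => poisson r (th - t) * 1) (fun t => poisson r (th - t))) in H by (intros; ring).
rewrite (avg_ext (fun t => poisson_partial r N (th - t) * 1) (fun t => poisson_partial r N (th - t))) in H by (intros; ring).
rewrite avg_partial in H.
lra.
Qed.

(** The denominator of the kernel is [(1 - r) ^ 2 + 2 * r * (1 - cos s)], so the kernel times
    [1 - cos s] is an affine function of the kernel, whose mean is 1. The value [1 - r] measures how
    the kernel concentrates as [r] tends to 1. *)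
Lemma avg_poisson_cos r th : 0 < r < 1 ->
  avg (fun t => poisson r (th - t) * (1 - cos (th - t))) = 1 - r.
Proof.
intros Hr. assert (Hr' : 0 <= r < 1) by lra.
rewrite (avg_ext _ (fun t => (1 - r ^ 2) / (2 * r) + (- (1 - r) ^ 2 / (2 * r)) * poisson r (th - t))).
- rewrite avg_plus, avg_const, avg_scal, avg_poisson by (first [assumption|continuity_solver]).
  field. lra.
- intros t. assert (H := poisson_denominator_pos r (th - t) Hr').
  unfold poisson. field. lra.
Qed.

(** Expressing the modulus of continuity through [1 - cos] avoids splitting the circle into a near
    and a far arc: the kernel integrates this weight exactly. *)
Lemma poisson_approximate_identity g r th e C :
  continuous_fun g -> 0 < r < 1 ->
  (forall t, Rabs (g t - g th) <= e + C * (1 - cos (th - t))) ->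
  Rabs (avg (fun t => poisson r (th - t) * g t) - g th) <= e + C * (1 - r).
Proof.
intros Hg Hr HC. assert (Hr' : 0 <= r < 1) by lra.
assert (CP := continuous_fun_poisson r th Hr').
assert (Cc : continuous_fun (fun t => 1 - cos (th - t))).
{ intros t. apply (ex_derive_continuous (K := R_AbsRing) (V := R_NormedModule)). auto_derive. trivial. }
replace (avg (fun t => poisson r (th - t) * g t) - g th)
  with (avg (fun t => poisson r (th - t) * g t + (- g th) * poisson r (th - t))).
2:{ rewrite avg_plus, avg_scal, avg_poisson by (first [assumption|continuity_solver]). ring. }
replace (e + C * (1 - r))
  with (avg (fun t => e * poisson r (th - t) + C * (poisson r (th - t) * (1 - cos (th - t))))).
2:{ rewrite avg_plus, !avg_scal, avg_poisson, avg_poisson_cos by (first [assumption|continuity_solver]). ring. }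
apply avg_abs.
- continuity_solver.
- continuity_solver.
- intros t. replace (poisson r (th - t) * g t + - g th * poisson r (th - t))
    with (poisson r (th - t) * (g t - g th)) by ring.
  assert (HP := poisson_pos r (th - t) Hr').
  rewrite Rabs_mult, Rabs_pos_eq by assumption.
  assert (H := HC t). nra.
Qed.

(** The difference of the two fractions has the factor [b - a]; the cofactor in the numerator is at
    most 8 and each denominator is at least [(1 - b) ^ 2]. This pays for replacing the radius
    [s * r] by [r] in [poisson_formula]. *)
Lemma poisson_lipschitz (a b s : R) : 0 <= a <= b -> b < 1 ->
  Rabs (poisson a s - poisson b s) <= 8 / (1 - b) ^ 4 * (b - a).
Proof.
intros Hab Hb.
assert (H0 : 0 < (1 - b) ^ 2) by (apply pow_lt; lra).
assert (DA := poisson_denominator_pos a s ltac:(lra)). assert (DB := poisson_denominator_pos b s ltac:(lra)).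
assert (EA := poisson_denominator a s ltac:(lra)). assert (EB := poisson_denominator b s ltac:(lra)).
assert (EA' : (1 - b) ^ 2 <= 1 - 2 * a * cos s + a ^ 2) by nra.
assert (Hc := COS_bound s).
unfold poisson. set (c := cos s) in *.
set (X := 1 - 2 * a * c + a ^ 2) in *. set (Y := 1 - 2 * b * c + b ^ 2) in *.
replace ((1 - a ^ 2) / X - (1 - b ^ 2) / Y)
  with ((b - a) * (2 * (a + b) - 2 * c * (1 + a * b)) / (X * Y)) by (unfold X, Y; field; fold X Y; lra).
assert (HXY : (1 - b) ^ 4 <= X * Y).
{ replace ((1 - b) ^ 4) with ((1 - b) ^ 2 * (1 - b) ^ 2) by ring. apply Rmult_le_compat; lra. }
unfold Rdiv. rewrite Rabs_mult, Rabs_mult, (Rabs_pos_eq (b - a)) by lra.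
assert (H4 : 0 < (1 - b) ^ 4) by (apply pow_lt; lra).
rewrite (Rabs_pos_eq (/ (X * Y))) by (left; apply Rinv_0_lt_compat; nra).
assert (Hin : / (X * Y) <= / (1 - b) ^ 4) by (apply Rinv_le_contravar; assumption).
assert (Hin0 : 0 < / (X * Y)) by (apply Rinv_0_lt_compat; nra).
assert (Hn : Rabs (2 * (a + b) - 2 * c * (1 + a * b)) <= 8).
{ assert (0 <= a * b <= 1) by nra. apply Rabs_le; nra. }
assert (Hn0 := Rabs_pos (2 * (a + b) - 2 * c * (1 + a * b))).
replace (8 * / (1 - b) ^ 4 * (b - a)) with ((b - a) * 8 * / (1 - b) ^ 4) by ring.
apply Rmult_le_compat; try lra; [apply Rmult_le_pos; lra|]. apply Rmult_le_compat_l; lra.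
Qed.

(** * Powers of z and harmonic polynomials *)

(* [P + iQ] is holomorphic with derivative [P' + iQ']. *)
Definition cauchy_riemann (P Q P' Q' : R -> R -> R) : Prop :=
  forall x y, is_derive (fun t => P t y) x (P' x y) /\ is_derive (fun t => Q t y) x (Q' x y) /\
    is_derive (fun t => P x t) y (- Q' x y) /\ is_derive (fun t => Q x t) y (P' x y).

Lemma cauchy_riemann_mul_z P Q P' Q' : cauchy_riemann P Q P' Q' ->
  cauchy_riemann (fun x y => x * P x y - y * Q x y) (fun x y => x * Q x y + y * P x y)
    (fun x y => P x y + (x * P' x y - y * Q' x y)) (fun x y => Q x y + (x * Q' x y + y * P' x y)).
Proof.
intros H x y. destruct (H x y) as (H1 & H2 & H3 & H4).
assert (D1 : Derive (fun t => P t y) x = P' x y) by (apply is_derive_unique; exact H1).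
assert (D2 : Derive (fun t => Q t y) x = Q' x y) by (apply is_derive_unique; exact H2).
assert (D3 : Derive (fun t => P x t) y = - Q' x y) by (apply is_derive_unique; exact H3).
assert (D4 : Derive (fun t => Q x t) y = P' x y) by (apply is_derive_unique; exact H4).
split; [|split; [|split]]; auto_derive;
  repeat match goal with
  | |- _ /\ _ => split
  | |- ex_derive _ _ => eexists; eassumption
  | |- True => exact I
  end;
  rewrite ?D1, ?D2, ?D3, ?D4; ring.
Qed.

Lemma cauchy_riemann_plus P Q P' Q' A B A' B' : cauchy_riemann P Q P' Q' -> cauchy_riemann A B A' B' ->
  cauchy_riemann (fun x y => P x y + A x y) (fun x y => Q x y + B x y)
    (fun x y => P' x y + A' x y) (fun x y => Q' x y + B' x y).
Proof.
intros H K x y. destruct (H x y) as (H1 & H2 & H3 & H4). destruct (K x y) as (K1 & K2 & K3 & K4).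
split; [|split; [|split]]; try (refine (is_derive_plus _ _ _ _ _ _ _); assumption).
replace (- (Q' x y + B' x y)) with (- Q' x y + - B' x y) by ring.
refine (is_derive_plus _ _ _ _ _ _ _); assumption.
Qed.

Fixpoint zpow (n : nat) (x y : R) : R * R :=
  match n with
  | O => (1, 0)
  | S n => (x * fst (zpow n x y) - y * snd (zpow n x y), x * snd (zpow n x y) + y * fst (zpow n x y))
  end.

(** Two derivatives are carried through the induction because harmonicity is a second-order
    statement: with [F] the current power, the next one has derivative [F + z F'], which can be
    differentiated again by the same rules. *)
Lemma zpow_derivatives n : exists P' Q' P'' Q'',
  cauchy_riemann (fun x y => fst (zpow n x y)) (fun x y => snd (zpow n x y)) P' Q' /\
  cauchy_riemann P' Q' P'' Q''.
Proof.
induction n as [|n (P' & Q' & P'' & Q'' & H1 & H2)].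
- exists (fun _ _ => 0), (fun _ _ => 0), (fun _ _ => 0), (fun _ _ => 0).
  split; intros x y; (split; [|split; [|split]]); simpl; auto_derive; trivial; ring.
- do 4 eexists. split; [apply (cauchy_riemann_mul_z _ _ _ _ H1)|].
  apply (cauchy_riemann_plus _ _ _ _ _ _ _ _ H1 (cauchy_riemann_mul_z _ _ _ _ H2)).
Qed.

Lemma zpow_cont2 n x y : cont2 (fun x y => fst (zpow n x y)) x y /\ cont2 (fun x y => snd (zpow n x y)) x y.
Proof.
unfold cont2. induction n as [|n [IH1 IH2]]; simpl.
- split; apply continuous_const.
- split; [refine (continuous_minus _ _ _ _ _)|refine (continuous_plus _ _ _ _ _)];
  refine (continuous_mult _ _ _ _ _); try assumption; try apply continuous_fst; apply continuous_snd.
Qed.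

Lemma zpow_harmonic n : weakly_harmonic (fun x y => fst (zpow n x y)) /\ weakly_harmonic (fun x y => snd (zpow n x y)).
Proof.
destruct (zpow_derivatives n) as (P' & Q' & P'' & Q'' & H1 & H2). split; split.
- intros x y. exact (proj1 (zpow_cont2 n x y)).
- exists P', (fun x y => - Q' x y), P'', (fun x y => - P'' x y). intros x y.
  destruct (H1 x y) as (A1 & A2 & A3 & A4). destruct (H2 x y) as (B1 & B2 & B3 & B4).
  split; [|split; [|split; [|split]]]; try assumption; [|ring].
  refine (is_derive_opp _ _ _ _). assumption.
- intros x y. exact (proj2 (zpow_cont2 n x y)).
- exists Q', P', Q'', (fun x y => - Q'' x y). intros x y.
  destruct (H1 x y) as (A1 & A2 & A3 & A4). destruct (H2 x y) as (B1 & B2 & B3 & B4).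
  split; [|split; [|split; [|split]]]; try assumption; ring.
Qed.

Lemma zpow_polar n r t :
  fst (zpow n (r * cos t) (r * sin t)) = r ^ n * cos (INR n * t) /\
  snd (zpow n (r * cos t) (r * sin t)) = r ^ n * sin (INR n * t).
Proof.
induction n as [|n [IH1 IH2]].
- simpl. rewrite Rmult_0_l, cos_0, sin_0. lra.
- simpl zpow. cbn [fst snd]. rewrite IH1, IH2.
  replace (INR (S n) * t) with (INR n * t + t) by (rewrite S_INR; ring).
  rewrite cos_plus, sin_plus. simpl. split; ring.
Qed.

(** When [g] is the trace of a harmonic function, this is the term [P_j] of its expansion. *)
Definition circle_term (g : R -> R) (j : nat) (th : R) : R := avg (fun t => mode j (th - t) * g t).

Lemma partial_sum_terms g r N th : continuous_fun g ->
  avg (fun t => poisson_partial r N (th - t) * g t) = sum_f_R0 (fun j => r ^ j * circle_term g j th) N.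
Proof.
intros Hg. unfold circle_term, poisson_partial.
assert (C : forall j, continuous_fun (fun t => mode j (th - t) * g t)).
{ intros j. apply continuous_fun_mult; [apply continuous_fun_mode|assumption]. }
induction N as [|N IH]; simpl sum_f_R0.
- rewrite <- avg_scal by apply C. apply avg_ext; intros; ring.
- rewrite <- IH, <- avg_scal, <- avg_plus.
  + apply avg_ext; intros; ring.
  + apply continuous_fun_mult; [apply continuous_fun_partial|assumption].
  + apply continuous_fun_mult; [apply continuous_fun_const|apply C].
  + apply C.
Qed.

(** The truncated Poisson mean of [g], dilated by [s] and written with real and imaginary parts of
    powers of z, which makes it harmonic term by term. *)
Definition harmonic_polynomial (g : R -> R) (s : R) (N : nat) (x y : R) : R :=
  sum_f_R0 (fun j => s ^ j * (cf j * (avg (fun t => cos (INR j * t) * g t) * fst (zpow j x y)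
    + avg (fun t => sin (INR j * t) * g t) * snd (zpow j x y)))) N.

Lemma harmonic_polynomial_harmonic g s N : weakly_harmonic (harmonic_polynomial g s N).
Proof.
unfold harmonic_polynomial.
assert (Ht : forall j, weakly_harmonic (fun x y => s ^ j * (cf j * (avg (fun t => cos (INR j * t) * g t) * fst (zpow j x y)
    + avg (fun t => sin (INR j * t) * g t) * snd (zpow j x y))))).
{ intros j. destruct (zpow_harmonic j) as [H1 H2].
  assert (H := weakly_harmonic_lin _ _ (s ^ j * cf j) 0
    (weakly_harmonic_lin _ _ (avg (fun t => cos (INR j * t) * g t)) (avg (fun t => sin (INR j * t) * g t)) H1 H2) H1).
  eapply weakly_harmonic_ext; [|exact H]. intros; simpl; ring. }
induction N as [|N IH]; simpl sum_f_R0.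
- exact (Ht O).
- assert (H := weakly_harmonic_lin _ _ 1 1 IH (Ht (S N))).
  eapply weakly_harmonic_ext; [|exact H]. intros; simpl; ring.
Qed.

Lemma harmonic_polynomial_polar g s N r th : continuous_fun g ->
  harmonic_polynomial g s N (r * cos th) (r * sin th)
  = avg (fun t => poisson_partial (s * r) N (th - t) * g t).
Proof.
intros Hg. rewrite partial_sum_terms by assumption. apply sum_eq. intros j _.
destruct (zpow_polar j r th) as [-> ->]. rewrite Rpow_mult_distr.
assert (Cc : continuous_fun (fun t => cos (INR j * t) * g t)).
{ apply continuous_fun_mult; [|assumption]. intros t.
  apply (ex_derive_continuous (K := R_AbsRing) (V := R_NormedModule)). auto_derive. trivial. }
assert (Cs : continuous_fun (fun t => sin (INR j * t) * g t)).
{ apply continuous_fun_mult; [|assumption]. intros t.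
  apply (ex_derive_continuous (K := R_AbsRing) (V := R_NormedModule)). auto_derive. trivial. }
replace (circle_term g j th) with (cf j * cos (INR j * th) * avg (fun t => cos (INR j * t) * g t)
  + cf j * sin (INR j * th) * avg (fun t => sin (INR j * t) * g t)); [ring|].
unfold circle_term. rewrite <- !avg_scal, <- avg_plus; try assumption;
  try (apply continuous_fun_mult; [apply continuous_fun_const|assumption]).
apply avg_ext. intros t. unfold mode.
replace (INR j * (th - t)) with (INR j * th - INR j * t) by ring. rewrite cos_minus. ring.
Qed.

(** * Boundary values and the Poisson formula *)

Definition trace (w : R -> R -> R) (t : R) : R := w (cos t) (sin t).

Lemma continuous_fun_trace w : (forall x y, cont2 w x y) -> continuous_fun (trace w).
Proof.
intros Hw t.
refine (continuous_comp_2 cos sin w t _ _ _); [| |apply Hw];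
  apply continuity_pt_filterlim; [apply continuity_cos|apply continuity_sin].
Qed.

Lemma bounded_disc w : (forall x y, cont2 w x y) ->
  exists M, forall x y, x ^ 2 + y ^ 2 <= 1 -> Rabs (w x y) <= M.
Proof.
intros Hw.
destruct (extreme_value_disc w Hw) as (a & b & _ & H1).
destruct (extreme_value_disc (fun x y => - w x y)) as (c & d & _ & H2).
{ intros x y. refine (continuous_opp _ _ _). apply Hw. }
exists (Rmax (w a b) (- w c d)). intros x y Hxy.
assert (K1 := H1 x y Hxy). assert (K2 := H2 x y Hxy). simpl in K2.
assert (K3 := Rmax_l (w a b) (- w c d)). assert (K4 := Rmax_r (w a b) (- w c d)).
apply Rabs_le. lra.
Qed.

Lemma circle_in_disc t : cos t ^ 2 + sin t ^ 2 <= 1.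
Proof. assert (H := sin2_cos2 t). unfold Rsqr in H. lra. Qed.

(** The squared chord between the points at angles [s] and [t] is [2 * (1 - cos (s - t))]. For a
    chord below [d], uniform continuity gives [e]; otherwise [1 - cos (s - t)] is at least
    [d ^ 2 / 2], and [C = 4 * M / d ^ 2] absorbs the largest possible oscillation [2 * M]. *)
Lemma trace_modulus w e : (forall x y, cont2 w x y) -> 0 < e ->
  exists C, 0 <= C /\ forall s t, Rabs (trace w t - trace w s) <= e + C * (1 - cos (s - t)).
Proof.
intros Hw He. destruct (bounded_disc w Hw) as [M HM].
destruct (uniform_continuity_2d w (-1) 1 (-1) 1) with (eps := mkposreal e He) as [d Hd].
{ intros; apply continuity_2d_cont2, Hw. }
assert (Hd0 := cond_pos d). simpl in Hd.
assert (HM0 : 0 <= M).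
{ apply Rle_trans with (Rabs (w 0 0)); [apply Rabs_pos|apply HM; lra]. }
exists (4 * M / d ^ 2). split.
{ apply Rmult_le_pos; [lra|]. left. apply Rinv_0_lt_compat, pow_lt, Hd0. }
intros s t.
assert (Hdist : (cos t - cos s) ^ 2 + (sin t - sin s) ^ 2 = 2 * (1 - cos (s - t))).
{ rewrite cos_minus. assert (H1 := sin2_cos2 s). assert (H2 := sin2_cos2 t). unfold Rsqr in *. lra. }
assert (Hc := COS_bound (s - t)).
assert (HC0 : 0 <= 4 * M / d ^ 2).
{ apply Rmult_le_pos; [lra|]. left. apply Rinv_0_lt_compat, pow_lt, Hd0. }
destruct (Rlt_or_le ((cos t - cos s) ^ 2 + (sin t - sin s) ^ 2) (d ^ 2)) as [Hlt|Hge].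
- apply Rle_trans with e; [|nra]. left.
  assert (Habs : forall a b : R, a ^ 2 + b ^ 2 < d ^ 2 -> Rabs a < d).
  { intros a b Hab. apply Rabs_def1; nra. }
  apply Hd; try apply COS_bound; try apply SIN_bound; eapply Habs; [exact Hlt|].
  rewrite Rplus_comm. exact Hlt.
- apply Rle_trans with (2 * M).
  + unfold trace, Rminus. eapply Rle_trans; [apply Rabs_triang|]. rewrite Rabs_Ropp.
    assert (H1 := HM _ _ (circle_in_disc s)). assert (H2 := HM _ _ (circle_in_disc t)). lra.
  + apply Rle_trans with (4 * M / d ^ 2 * (d ^ 2 / 2)).
    * right. field. lra.
    * assert (4 * M / d ^ 2 * (d ^ 2 / 2) <= 4 * M / d ^ 2 * (1 - cos (s - t))); [|lra].
      apply Rmult_le_compat_l; lra.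
Qed.

(* The boundary values are uniformly close to a trigonometric polynomial, whose harmonic extension is explicit; the maximum principle transfers the estimate to the disc. *)
Lemma poisson_formula w r th : weakly_harmonic w -> 0 <= r < 1 ->
  w (r * cos th) (r * sin th) = avg (fun t => poisson r (th - t) * trace w t).
Proof.
intros Hw Hr. assert (Hc := proj1 Hw). assert (Cg := continuous_fun_trace w Hc).
set (g := trace w) in *.
destruct (bounded_disc w Hc) as [M HM].
assert (Hg : forall t, Rabs (g t) <= M) by (intros t; apply HM, circle_in_disc).
assert (HM0 : 0 <= M) by (apply Rle_trans with (Rabs (g 0)); [apply Rabs_pos|apply Hg]).
apply cond_eq. intros e He.
destruct (trace_modulus w (e / 8) Hc) as (C & HC0 & HC); [lra|]. fold g in HC.
(* Both costs proportional to [1 - s]: approaching the boundary values from radius [s], and moving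
   the inner radius from [s * r] to [r]. *)
set (L := C + M * (8 / (1 - r) ^ 4)).
assert (HL : 0 <= M * (8 / (1 - r) ^ 4)).
{ apply Rmult_le_pos; [lra|]. apply Rmult_le_pos; [lra|]. left. apply Rinv_0_lt_compat, pow_lt. lra. }
assert (Hs : exists s, 0 < s < 1 /\ L * (1 - s) <= e / 8).
{ exists (1 - Rmin (1 / 2) (e / 8 / (L + 1))).
  assert (H1 := Rmin_l (1 / 2) (e / 8 / (L + 1))). assert (H2 := Rmin_r (1 / 2) (e / 8 / (L + 1))).
  assert (H3 : 0 < Rmin (1 / 2) (e / 8 / (L + 1))).
  { apply Rmin_pos; [lra|]. apply Rdiv_lt_0_compat; unfold L; lra. }
  split; [lra|].
  replace (1 - (1 - Rmin (1 / 2) (e / 8 / (L + 1)))) with (Rmin (1 / 2) (e / 8 / (L + 1))) by ring.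
  apply Rle_trans with ((L + 1) * (e / 8 / (L + 1))); [|right; field; unfold L; lra].
  apply Rmult_le_compat; unfold L in *; lra. }
destruct Hs as (s & Hs & HLs).
assert (Hs' : 0 <= s < 1) by lra.
destruct (pow_small s (M * (4 / (1 - s) ^ 2)) (e / 8) Hs') as [N1 HN1]; [lra|].
assert (Hsr : 0 <= s * r <= r) by nra.
assert (Hsr' : 0 <= s * r < 1) by lra.
destruct (pow_small s (M * (4 / (1 - s * r) ^ 2)) (e / 8) Hs') as [N2 HN2]; [lra|].
set (N := (N1 + N2)%nat).
assert (Hp : forall n m K, 0 <= K -> K * s ^ (n + 1) <= e / 8 -> (n <= m)%nat -> K * s ^ (m + 1) <= e / 8).
{ intros n m K HK H Hnm. apply Rle_trans with (2 := H). apply Rmult_le_compat_l; [assumption|].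
  replace (m + 1)%nat with (n + 1 + (m - n))%nat by lia. rewrite pow_add.
  assert (0 <= s ^ (n + 1)) by (apply pow_le; lra).
  assert (s ^ (m - n) <= 1) by (rewrite <- (pow1 (m - n)); apply pow_incr; lra). nra. }
assert (HK : forall a, 0 <= a < 1 -> 0 <= M * (4 / (1 - a) ^ 2)).
{ intros a Ha. apply Rmult_le_pos; [lra|]. apply Rmult_le_pos; [lra|]. left. apply Rinv_0_lt_compat, pow_lt. lra. }
apply Hp with (m := N) in HN1; [|apply HK, Hs'|unfold N; lia].
apply Hp with (m := N) in HN2; [|apply HK, Hsr'|unfold N; lia].
set (T := harmonic_polynomial g s N).
assert (HT : Rabs (w (r * cos th) (r * sin th) - T (r * cos th) (r * sin th)) <= 3 * (e / 8)).
{ assert (Hd := weakly_harmonic_lin w T 1 (-1) Hw (harmonic_polynomial_harmonic g s N)).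
  assert (HH := maximum_principle_abs _ (3 * (e / 8)) Hd).
  replace (w (r * cos th) (r * sin th) - T (r * cos th) (r * sin th))
    with (1 * w (r * cos th) (r * sin th) + -1 * T (r * cos th) (r * sin th)) by ring.
  apply HH.
  - intros t. assert (Hpol := harmonic_polynomial_polar g s N 1 t Cg).
    rewrite !Rmult_1_l, Rmult_1_r in Hpol. unfold T. rewrite Hpol. change (w (cos t) (sin t)) with (g t).
    assert (H1 := avg_poisson_truncation g s N t M Cg Hg Hs').
    assert (H2 := poisson_approximate_identity g s t (e / 8) C Cg Hs (HC t)).
    apply Rabs_le_between in H1. apply Rabs_le_between in H2.
    assert (C * (1 - s) <= L * (1 - s)) by (apply Rmult_le_compat_r; unfold L; lra).
    apply Rabs_le. lra.
  - assert (H := circle_in_disc th). nra. }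
assert (HT2 : Rabs (T (r * cos th) (r * sin th) - avg (fun t => poisson r (th - t) * g t)) <= 2 * (e / 8)).
{ unfold T. rewrite harmonic_polynomial_polar by assumption.
  assert (H1 := avg_poisson_truncation g (s * r) N th M Cg Hg Hsr').
  assert (H2 : Rabs (avg (fun t => poisson (s * r) (th - t) * g t) - avg (fun t => poisson r (th - t) * g t)) <= e / 8).
  { replace (avg (fun t => poisson (s * r) (th - t) * g t) - avg (fun t => poisson r (th - t) * g t))
      with (avg (fun t => poisson (s * r) (th - t) * g t + -1 * (poisson r (th - t) * g t))).
    2:{ rewrite avg_plus, avg_scal by continuity_solver. ring. }
    apply Rle_trans with (M * (8 / (1 - r) ^ 4) * (1 - s)).
    2:{ apply Rle_trans with (2 := HLs). apply Rmult_le_compat_r; unfold L; lra. }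
    rewrite <- (avg_const (M * (8 / (1 - r) ^ 4) * (1 - s))).
    apply avg_abs.
    - continuity_solver.
    - apply continuous_fun_const.
    - intros t.
      replace (poisson (s * r) (th - t) * g t + -1 * (poisson r (th - t) * g t))
        with (g t * (poisson (s * r) (th - t) - poisson r (th - t))) by ring.
      rewrite Rabs_mult, Rmult_assoc. apply Rmult_le_compat; try apply Rabs_pos; [apply Hg|].
      eapply Rle_trans; [apply poisson_lipschitz; lra|].
      apply Rmult_le_compat_l; [|nra].
      apply Rmult_le_pos; [lra|]. left. apply Rinv_0_lt_compat, pow_lt. lra. }
  assert (H3 : M * (4 / (1 - s * r) ^ 2) * (s * r) ^ (N + 1) <= e / 8).
  { apply Rle_trans with (2 := HN2). apply Rmult_le_compat_l; [apply HK, Hsr'|].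
    apply pow_incr. nra. }
  apply Rabs_le_between in H1. apply Rabs_le_between in H2. apply Rabs_le. lra. }
apply Rabs_le_between in HT. apply Rabs_le_between in HT2. apply Rabs_def1; lra.
Qed.

(** The error involves [w] only through [M]; this is the source of the uniformity over all maps in
    [modes_small] and [small_on_half_disc]. *)
Lemma harmonic_expansion w M N r th : weakly_harmonic w -> (forall t, Rabs (trace w t) <= M) -> 0 <= r < 1 ->
  Rabs (w (r * cos th) (r * sin th) - sum_f_R0 (fun j => r ^ j * circle_term (trace w) j th) N)
  <= M * (4 / (1 - r) ^ 2) * r ^ (N + 1).
Proof.
intros Hw HM Hr. assert (C := continuous_fun_trace w (proj1 Hw)).
rewrite poisson_formula, <- partial_sum_terms by assumption. apply avg_poisson_truncation; assumption.
Qed.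

(** For [r <= 1 / 2] the Poisson kernel lies between [1 / 3] and [3], and the value at the centre is
    the plain mean of the trace. *)
Lemma harnack_disc w x y : weakly_harmonic w -> (forall t, 0 <= trace w t) -> x ^ 2 + y ^ 2 <= 1 / 4 ->
  w 0 0 <= 3 * w x y /\ w x y <= 3 * w 0 0.
Proof.
intros Hw Hpos Hxy. assert (C := continuous_fun_trace w (proj1 Hw)).
destruct (polar_coordinates x y) as (r & th & Hr & Hr2 & _ & -> & ->).
assert (Hr' : 0 <= r <= 1 / 2) by nra.
assert (H0 : w 0 0 = avg (trace w)).
{ assert (H := poisson_formula w 0 0 Hw ltac:(lra)). rewrite !Rmult_0_l in H. rewrite H.
  apply avg_ext. intros t. unfold poisson. field. }
rewrite poisson_formula by (try assumption; lra).
assert (HP : forall s, 1 / 3 <= poisson r s <= 3).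
{ intros s. assert (H := poisson_denominator_pos r s ltac:(lra)). assert (Hcos := COS_bound s).
  assert (- r <= r * cos s <= r) by nra.
  assert ((1 + r) ^ 2 <= 3 * (1 - r ^ 2)) by nra. assert (1 - r ^ 2 <= 3 * (1 - r) ^ 2) by nra.
  unfold poisson. split.
  - apply (proj1 (Rle_div_r _ _ _ H)). lra.
  - apply (proj2 (Rle_div_l _ _ _ H)). lra. }
assert (CP := continuous_fun_poisson r th ltac:(lra)).
rewrite H0, <- !avg_scal by continuity_solver.
split; (apply avg_le; [continuity_solver|continuity_solver|]).
- intros t. assert (H1 := HP (th - t)). assert (H2 := Hpos t). nra.
- intros t. assert (H1 := HP (th - t)). assert (H2 := Hpos t). nra.
Qed.

Lemma circle_term_antiperiodic g j th : (0 < j)%nat -> continuous_fun g ->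
  circle_term g j (th + PI / INR j) = - circle_term g j th.
Proof.
intros Hj Hg. unfold circle_term.
replace (- avg (fun t => mode j (th - t) * g t)) with (-1 * avg (fun t => mode j (th - t) * g t)) by ring.
rewrite <- avg_scal by (apply continuous_fun_mult; [apply continuous_fun_mode|assumption]).
apply avg_ext. intros t. unfold mode.
replace (INR j * (th + PI / INR j - t)) with (INR j * (th - t) + PI).
- rewrite neg_cos. ring.
- field. apply not_0_INR. lia.
Qed.

Lemma circle_term_zero w th : weakly_harmonic w -> circle_term (trace w) 0 th = w 0 0.
Proof.
intros Hw. assert (H := poisson_formula w 0 0 Hw ltac:(lra)). rewrite !Rmult_0_l in H. rewrite H.
apply avg_ext. intros t. unfold poisson, mode. simpl. rewrite !Rmult_0_l, cos_0. field.
Qed.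

(** * Mode expansion under separation *)

Definition norm2 (a b : R) : R := sqrt (a ^ 2 + b ^ 2).

Lemma norm2_pos a b : 0 <= norm2 a b.
Proof. apply sqrt_pos. Qed.

Lemma norm2_sqr a b : norm2 a b * norm2 a b = a ^ 2 + b ^ 2.
Proof. apply sqrt_sqrt. nra. Qed.

Lemma norm2_le a b m : 0 <= m -> a ^ 2 + b ^ 2 <= m * m -> norm2 a b <= m.
Proof. intros Hm H. assert (H1 := norm2_sqr a b). assert (H2 := norm2_pos a b). nra. Qed.

Lemma norm2_le_sum a b : norm2 a b <= Rabs a + Rabs b.
Proof.
assert (H1 := Rabs_pos a). assert (H2 := Rabs_pos b). apply norm2_le; [lra|].
rewrite <- (pow2_abs a), <- (pow2_abs b). nra.
Qed.

Lemma Rabs_le_norm2 a b : Rabs a <= norm2 a b /\ Rabs b <= norm2 a b.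
Proof.
assert (H := norm2_sqr a b). assert (H0 := norm2_pos a b). split; apply Rabs_le; nra.
Qed.

Lemma dot_le_norm2 a b c d : Rabs (a * c + b * d) <= norm2 a b * norm2 c d.
Proof.
assert (H1 := norm2_sqr a b). assert (H2 := norm2_sqr c d).
assert (H3 := norm2_pos a b). assert (H4 := norm2_pos c d).
assert (H5 : 0 <= norm2 a b * norm2 c d) by nra.
assert (H6 : (norm2 a b * norm2 c d) * (norm2 a b * norm2 c d) = (a ^ 2 + b ^ 2) * (c ^ 2 + d ^ 2)).
{ rewrite <- H1, <- H2. ring. }
set (m := norm2 a b * norm2 c d) in *. clearbody m.
assert (H7 : (a * c + b * d) ^ 2 <= m * m).
{ rewrite H6. assert (0 <= (a * d - b * c) ^ 2) by apply pow2_ge_0. nra. }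
apply Rabs_le. nra.
Qed.

Lemma norm2_triangle a b c d : norm2 (a + c) (b + d) <= norm2 a b + norm2 c d.
Proof.
assert (H := dot_le_norm2 a b c d). apply Rabs_le_between in H.
assert (H1 := norm2_sqr a b). assert (H2 := norm2_sqr c d).
assert (H3 := norm2_pos a b). assert (H4 := norm2_pos c d).
apply norm2_le; nra.
Qed.

Lemma norm2_opp a b : norm2 (- a) (- b) = norm2 a b.
Proof. unfold norm2. f_equal. ring. Qed.

(* Values of modulus greater than [rho] stay uniformly away from being antipodal. *)
Definition separated (u v : R -> R -> R) (rho c : R) : Prop :=
  forall x y x' y', rho < norm2 (u x y) (v x y) -> rho < norm2 (u x' y') (v x' y') ->
  - (1 - c) * (norm2 (u x y) (v x y) * norm2 (u x' y') (v x' y')) <= u x y * u x' y' + v x y * v x' y'.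

(** With relative errors [c / 8], the inner product is at most [- (1 - 3 * (c / 8))] and the product
    of the norms at most [(1 + c / 8) ^ 2], in units of the squared norm of [(a, b)]. The choice
    works because [(1 - c) * (1 + c / 8) ^ 2 < 1 - 3 * (c / 8)]. The bounds by half the norm serve
    to place both vectors above the threshold of separation. *)
Lemma almost_antipodal a b e1 e2 d1 d2 c : 0 < c <= 1 -> 0 < norm2 a b ->
  norm2 e1 e2 <= c / 8 * norm2 a b -> norm2 d1 d2 <= c / 8 * norm2 a b ->
  norm2 a b / 2 <= norm2 (a + e1) (b + e2) /\ norm2 a b / 2 <= norm2 (- a + d1) (- b + d2) /\
  (a + e1) * (- a + d1) + (b + e2) * (- b + d2)
    < - (1 - c) * (norm2 (a + e1) (b + e2) * norm2 (- a + d1) (- b + d2)).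
Proof.
intros Hc HA He Hd.
assert (X := norm2_triangle a b e1 e2). assert (Y := norm2_triangle (- a) (- b) d1 d2).
rewrite norm2_opp in Y.
assert (X' := norm2_triangle (a + e1) (b + e2) (- e1) (- e2)).
assert (Y' := norm2_triangle (- a + d1) (- b + d2) (- d1) (- d2)).
rewrite norm2_opp in X', Y'.
replace (a + e1 + - e1) with a in X' by ring. replace (b + e2 + - e2) with b in X' by ring.
replace (- a + d1 + - d1) with (- a) in Y' by ring. replace (- b + d2 + - d2) with (- b) in Y' by ring.
rewrite norm2_opp in Y'.
assert (K1 := dot_le_norm2 a b d1 d2). assert (K2 := dot_le_norm2 a b e1 e2). assert (K3 := dot_le_norm2 e1 e2 d1 d2).
apply Rabs_le_between in K1. apply Rabs_le_between in K2. apply Rabs_le_between in K3.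
assert (S := norm2_sqr a b).
assert (Pe := norm2_pos e1 e2). assert (Pd := norm2_pos d1 d2).
assert (Px := norm2_pos (a + e1) (b + e2)). assert (Py := norm2_pos (- a + d1) (- b + d2)).
set (A := norm2 a b) in *. set (e := norm2 e1 e2) in *. set (d := norm2 d1 d2) in *.
set (x := norm2 (a + e1) (b + e2)) in *. set (y := norm2 (- a + d1) (- b + d2)) in *.
assert (HcA : c / 8 * A <= A / 8) by nra.
split; [lra|]. split; [lra|].
assert (L1 : A * d <= c / 8 * (A * A)) by nra.
assert (L2 : A * e <= c / 8 * (A * A)) by nra.
assert (L3 : e * d <= c / 8 * (A * A)) by nra.
assert (L4 : x * y <= (1 + c / 8) ^ 2 * (A * A)).
{ replace ((1 + c / 8) ^ 2 * (A * A)) with (((1 + c / 8) * A) * ((1 + c / 8) * A)) by ring.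
  apply Rmult_le_compat; lra. }
assert (L5 : (a + e1) * (- a + d1) + (b + e2) * (- b + d2) <= - (1 - 3 * (c / 8)) * (A * A)).
{ replace ((a + e1) * (- a + d1) + (b + e2) * (- b + d2))
    with (- (a ^ 2 + b ^ 2) + (a * d1 + b * d2) - (a * e1 + b * e2) + (e1 * d1 + e2 * d2)) by ring.
  rewrite <- S. lra. }
assert (L6 : (1 - c) * (x * y) <= (1 - c) * ((1 + c / 8) ^ 2 * (A * A))) by (apply Rmult_le_compat_l; lra).
assert (L7 : (1 - c) * (1 + c / 8) ^ 2 < 1 - 3 * (c / 8)).
{ assert (0 < c ^ 2) by (apply pow_lt; lra). assert (0 < c ^ 3) by (apply pow_lt; lra). lra. }
assert (0 < A * A) by nra. nra.
Qed.

Lemma sum_le_const (f : nat -> R) (m : R) N : (forall j, (j <= N)%nat -> Rabs (f j) <= m) ->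
  Rabs (sum_f_R0 f N) <= INR (S N) * m.
Proof.
intros H. eapply Rle_trans; [apply sum_f_R0_triangle|].
rewrite Rmult_comm, <- sum_cte. apply sum_Rle. exact H.
Qed.

Lemma pow_le_1 r j : 0 <= r <= 1 -> 0 <= r ^ j <= 1.
Proof. intros Hr. split; [apply pow_le; lra|rewrite <- (pow1 j); apply pow_incr; lra]. Qed.

Lemma half_disc_factor r : 0 <= r <= 1 / 2 -> 0 < 4 / (1 - r) ^ 2 <= 16.
Proof.
intros Hr. assert (0 < (1 - r) ^ 2) by nra. split; [apply Rdiv_lt_0_compat; lra|].
apply (proj2 (Rle_div_l _ _ _ H)). nra.
Qed.

(* If all modes below [S k] are tiny, then on a suitable small circle the mode [S k] dominates [u + iv] as soon as it is not tiny; as this mode is antiperiodic, it produces almost antipodal values. *)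
Lemma modes_small C c : 0 < C -> 0 < c <= 1 -> forall k e, 0 < e -> exists e', 0 < e' /\
  forall u v, weakly_harmonic u -> weakly_harmonic v ->
  (forall t, Rabs (trace u t) <= C) -> (forall t, Rabs (trace v t) <= C) ->
  norm2 (u 0 0) (v 0 0) <= e' -> separated u v e' c ->
  forall j th, (j <= k)%nat -> norm2 (circle_term (trace u) j th) (circle_term (trace v) j th) <= e.
Proof.
intros HC Hc k. induction k as [|k IH]; intros e He.
- exists e. split; [assumption|]. intros u v Hu Hv _ _ H0 _ j th Hj.
  replace j with O by lia. rewrite !circle_term_zero by assumption. exact H0.
(* At this radius the modes beyond [S k] sum to at most a quarter of the tolerance
   [c / 8 * (r ^ n * e)]. *)
- set (r := Rmin (1 / 2) (c * e / (512 * C))).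
  assert (Hr : 0 < r <= 1 / 2).
  { split; [|apply Rmin_l]. apply Rmin_pos; [lra|]. apply Rdiv_lt_0_compat; nra. }
  assert (Hr16 : 16 * C * r <= c / 8 * e / 4).
  { apply Rle_trans with (16 * C * (c * e / (512 * C))); [|right; field; lra].
    apply Rmult_le_compat_l; [lra|]. apply Rmin_r. }
  set (n := S k) in *.
  assert (Hrn : 0 < r ^ n) by (apply pow_lt; lra).
  assert (Hn : 0 < INR n) by (apply lt_0_INR; unfold n; lia).
  (* The [n] modes of index at most [k] use another quarter. Each coordinate is then off by at most
     half the tolerance, and the pair by at most the tolerance. *)
  set (e1 := Rmin e (c / 8 * e * r ^ n / (4 * INR n))).
  assert (Hcer : 0 < c / 8 * e * r ^ n) by (apply Rmult_lt_0_compat; [nra|assumption]).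
  assert (He1 : 0 < e1) by (apply Rmin_pos; [lra|apply Rdiv_lt_0_compat; lra]).
  destruct (IH e1 He1) as (e2 & He2 & Hsmall).
  (* A mode [n] of norm above [e] gives values of norm above [e * r ^ n / 2], so the separation
     hypothesis applies to them. *)
  exists (Rmin e2 (e * r ^ n / 2)). assert (Her : 0 < e * r ^ n) by nra.
  assert (M1 := Rmin_l e2 (e * r ^ n / 2)). assert (M2 := Rmin_r e2 (e * r ^ n / 2)).
  set (e' := Rmin e2 (e * r ^ n / 2)) in *.
  split; [apply Rmin_pos; lra|].
  intros u v Hu Hv Bu Bv H0 Hsep j th Hj.
  assert (Hlow : forall j th, (j <= k)%nat -> norm2 (circle_term (trace u) j th) (circle_term (trace v) j th) <= e1).
  { apply Hsmall; try assumption; [lra|]. intros x y x' y' K1 K2. apply Hsep; lra. }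
  destruct (Nat.eq_dec j n) as [->|Hjn].
  2:{ eapply Rle_trans; [apply Hlow; unfold n in *; lia|apply Rmin_l]. }
  apply Rnot_lt_le. intros Hbig.
  assert (Herr : forall w t, weakly_harmonic w -> (forall t, Rabs (trace w t) <= C) ->
    (forall j, (j <= k)%nat -> Rabs (circle_term (trace w) j t) <= e1) ->
    Rabs (w (r * cos t) (r * sin t) - r ^ n * circle_term (trace w) n t) <= c / 8 * (r ^ n * e) / 2).
  { intros w t Hw Bw Lw.
    assert (HE := harmonic_expansion w C n r t Hw Bw ltac:(lra)).
    unfold n in HE at 1. rewrite tech5 in HE. fold n in HE.
    assert (HS : Rabs (sum_f_R0 (fun j => r ^ j * circle_term (trace w) j t) k) <= INR n * e1).
    { apply sum_le_const. intros i Hi. rewrite Rabs_mult.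
      assert (Hp := pow_le_1 r i ltac:(lra)). rewrite (Rabs_pos_eq (r ^ i)) by lra.
      assert (Hi' := Lw i Hi). assert (Hi0 := Rabs_pos (circle_term (trace w) i t)). nra. }
    assert (HS' : INR n * e1 <= c / 8 * (r ^ n * e) / 4).
    { apply Rle_trans with (INR n * (c / 8 * e * r ^ n / (4 * INR n))); [|right; field; lra].
      apply Rmult_le_compat_l; [lra|apply Rmin_r]. }
    assert (HT : C * (4 / (1 - r) ^ 2) * r ^ (n + 1) <= c / 8 * (r ^ n * e) / 4).
    { rewrite pow_add, pow_1. assert (Hf := half_disc_factor r ltac:(lra)).
      apply Rle_trans with (C * 16 * (r ^ n * r)).
      - apply Rmult_le_compat_r; [nra|]. apply Rmult_le_compat_l; lra.
      - replace (C * 16 * (r ^ n * r)) with (r ^ n * (16 * C * r)) by ring.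
        replace (c / 8 * (r ^ n * e) / 4) with (r ^ n * (c / 8 * e / 4)) by field.
        apply Rmult_le_compat_l; lra. }
    apply Rabs_le_between in HE. apply Rabs_le_between in HS. apply Rabs_le. lra. }
  assert (Hlu : forall t j, (j <= k)%nat -> Rabs (circle_term (trace u) j t) <= e1).
  { intros t i Hi. eapply Rle_trans; [apply (Rabs_le_norm2 _ (circle_term (trace v) i t))|apply Hlow, Hi]. }
  assert (Hlv : forall t j, (j <= k)%nat -> Rabs (circle_term (trace v) j t) <= e1).
  { intros t i Hi. eapply Rle_trans; [apply (Rabs_le_norm2 (circle_term (trace u) i t))|apply Hlow, Hi]. }
  set (t := th + PI / INR n).
  assert (Eu := Herr u th Hu Bu (Hlu th)). assert (Eu' := Herr u t Hu Bu (Hlu t)).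
  assert (Ev := Herr v th Hv Bv (Hlv th)). assert (Ev' := Herr v t Hv Bv (Hlv t)).
  unfold t in Eu', Ev'.
  rewrite circle_term_antiperiodic in Eu', Ev' by first [unfold n; lia|apply continuous_fun_trace, Hu|apply continuous_fun_trace, Hv].
  fold t in Eu', Ev'.
  set (P := circle_term (trace u) n th) in *. set (Q := circle_term (trace v) n th) in *.
  assert (HN : norm2 (r ^ n * P) (r ^ n * Q) = r ^ n * norm2 P Q).
  { apply Rsqr_inj; [apply norm2_pos|apply Rmult_le_pos; [lra|apply norm2_pos]|].
    unfold Rsqr. rewrite norm2_sqr.
    replace (r ^ n * norm2 P Q * (r ^ n * norm2 P Q)) with (r ^ n * r ^ n * (norm2 P Q * norm2 P Q)) by ring.
    rewrite norm2_sqr. ring. }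
  assert (HA : r ^ n * e < norm2 (r ^ n * P) (r ^ n * Q)) by (rewrite HN; apply Rmult_lt_compat_l; lra).
  assert (Hce : c / 8 * (r ^ n * e) <= c / 8 * norm2 (r ^ n * P) (r ^ n * Q)) by (apply Rmult_le_compat_l; lra).
  destruct (almost_antipodal (r ^ n * P) (r ^ n * Q)
    (u (r * cos th) (r * sin th) - r ^ n * P) (v (r * cos th) (r * sin th) - r ^ n * Q)
    (u (r * cos t) (r * sin t) - r ^ n * - P) (v (r * cos t) (r * sin t) - r ^ n * - Q) c Hc) as (L1 & L2 & L3).
  + nra.
  + eapply Rle_trans; [apply norm2_le_sum|lra].
  + eapply Rle_trans; [apply norm2_le_sum|lra].
  + replace (r ^ n * P + (u (r * cos th) (r * sin th) - r ^ n * P)) with (u (r * cos th) (r * sin th)) in * by ring.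
    replace (r ^ n * Q + (v (r * cos th) (r * sin th) - r ^ n * Q)) with (v (r * cos th) (r * sin th)) in * by ring.
    replace (- (r ^ n * P) + (u (r * cos t) (r * sin t) - r ^ n * - P)) with (u (r * cos t) (r * sin t)) in * by ring.
    replace (- (r ^ n * Q) + (v (r * cos t) (r * sin t) - r ^ n * - Q)) with (v (r * cos t) (r * sin t)) in * by ring.
    assert (Hs := Hsep (r * cos th) (r * sin th) (r * cos t) (r * sin t)). lra.
Qed.

(** The cut-off [N] depends on [C] alone and makes the tail at most [1 / 16] for radii up to
    [1 / 2]; the remaining [N + 1] modes are then forced below [1 / (16 * (N + 1))] each. The bound
    [1 / 2] is the one that the disc of [doubling_disc] violates after division by [g]. *)
Lemma small_on_half_disc C c : 0 < C -> 0 < c <= 1 -> exists e, 0 < e /\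
  forall u v, weakly_harmonic u -> weakly_harmonic v ->
  (forall t, Rabs (trace u t) <= C) -> (forall t, Rabs (trace v t) <= C) ->
  norm2 (u 0 0) (v 0 0) <= e -> separated u v e c ->
  forall x y, x ^ 2 + y ^ 2 <= 1 / 4 -> norm2 (u x y) (v x y) < 1 / 2.
Proof.
intros HC Hc.
destruct (pow_small (1 / 2) (C * 16) (1 / 16)) as [N HN]; [lra|lra|].
assert (HS : 0 < INR (S N)) by (apply lt_0_INR; lia).
destruct (modes_small C c HC Hc N (1 / (16 * INR (S N)))) as (e & He & H).
{ apply Rdiv_lt_0_compat; lra. }
exists e. split; [assumption|]. intros u v Hu Hv Bu Bv H0 Hsep x y Hxy.
assert (Hm := H u v Hu Hv Bu Bv H0 Hsep).
destruct (polar_coordinates x y) as (r & t & Hr & Hr2 & _ & -> & ->).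
assert (Hr' : 0 <= r <= 1 / 2) by nra.
assert (Hf := half_disc_factor r Hr').
assert (HT : C * (4 / (1 - r) ^ 2) * r ^ (N + 1) <= 1 / 16).
{ apply Rle_trans with (2 := HN). apply Rmult_le_compat; [nra|apply pow_le; lra| |apply pow_incr; lra].
  apply Rmult_le_compat_l; [lra|apply Hf]. }
assert (HB : forall w, (forall j, (j <= N)%nat -> Rabs (circle_term (trace w) j t) <= 1 / (16 * INR (S N))) ->
  Rabs (sum_f_R0 (fun j => r ^ j * circle_term (trace w) j t) N) <= 1 / 16).
{ intros w Lw. replace (1 / 16) with (INR (S N) * (1 / (16 * INR (S N)))) by (field; lra).
  apply sum_le_const. intros i Hi. rewrite Rabs_mult.
  assert (Hp := pow_le_1 r i ltac:(lra)). rewrite (Rabs_pos_eq (r ^ i)) by lra.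
  assert (Hi' := Lw i Hi). assert (Hi0 := Rabs_pos (circle_term (trace w) i t)). nra. }
assert (SU := HB u). assert (SV := HB v).
assert (EU := harmonic_expansion u C N r t Hu Bu ltac:(lra)).
assert (EV := harmonic_expansion v C N r t Hv Bv ltac:(lra)).
assert (SU' := SU ltac:(intros i Hi; eapply Rle_trans; [apply (Rabs_le_norm2 _ (circle_term (trace v) i t))|apply Hm, Hi])).
assert (SV' := SV ltac:(intros i Hi; eapply Rle_trans; [apply (Rabs_le_norm2 (circle_term (trace u) i t))|apply Hm, Hi])).
apply Rle_lt_trans with (1 / 4); [|lra].
eapply Rle_trans; [apply norm2_le_sum|].
apply Rabs_le_between in EU. apply Rabs_le_between in EV.
apply Rabs_le_between in SU'. apply Rabs_le_between in SV'.
assert (Rabs (u (r * cos t) (r * sin t)) <= 1 / 8) by (apply Rabs_le; lra).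
assert (Rabs (v (r * cos t) (r * sin t)) <= 1 / 8) by (apply Rabs_le; lra).
lra.
Qed.

(** * Harnack inequality for the modulus *)

Lemma cos_sin_2atan T : cos (2 * atan T) = (1 - T ^ 2) / (1 + T ^ 2) /\ sin (2 * atan T) = 2 * T / (1 + T ^ 2).
Proof.
assert (HT : 0 < 1 + T²) by (assert (H := Rle_0_sqr T); lra).
assert (Hq := sqrt_sqrt (1 + T²) ltac:(lra)). assert (Hq0 := sqrt_lt_R0 _ HT).
rewrite cos_2a, sin_2a, cos_atan, sin_atan.
set (q := sqrt (1 + T²)) in *. replace (1 + T ^ 2) with (q * q) by (rewrite Hq; unfold Rsqr; ring).
split.
- replace (1 - T ^ 2) with (1 - T * T) by ring. field. lra.
- field. lra.
Qed.

(** Off the closed negative real axis this formula is a branch of the argument with values in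
    [(- PI, PI)], and its continuity can be read off. *)
Lemma half_angle X Y : 0 < norm2 X Y + X ->
  X = norm2 X Y * cos (2 * atan (Y / (norm2 X Y + X))) /\ Y = norm2 X Y * sin (2 * atan (Y / (norm2 X Y + X))).
Proof.
intros HD. assert (HN := norm2_sqr X Y). assert (HN0 := norm2_pos X Y).
destruct (cos_sin_2atan (Y / (norm2 X Y + X))) as [-> ->].
set (N := norm2 X Y) in *. clearbody N.
assert (HN1 : 0 < N) by nra.
assert (E1 : 1 + (Y / (N + X)) ^ 2 = 2 * N / (N + X)).
{ replace (1 + (Y / (N + X)) ^ 2) with ((N * N + 2 * N * X + (X ^ 2 + Y ^ 2)) / ((N + X) * (N + X))) by (field; lra).
  rewrite <- HN. field. lra. }
assert (E2 : 1 - (Y / (N + X)) ^ 2 = 2 * X / (N + X)).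
{ replace (1 - (Y / (N + X)) ^ 2) with ((N * N + 2 * N * X + X ^ 2 - Y ^ 2) / ((N + X) * (N + X))) by (field; lra).
  replace (Y ^ 2) with (N * N - X ^ 2) by lra. field. lra. }
rewrite E1, E2. split; field; lra.
Qed.

Lemma norm2_dot_cross a b c d :
  norm2 (a * c + b * d) (a * d - b * c) = norm2 a b * norm2 c d.
Proof.
unfold norm2. rewrite <- sqrt_mult by nra. f_equal. ring.
Qed.

Lemma continuous_segment (phi : R -> R -> R) x y x' y' t :
  cont2 phi (x + t * (x' - x)) (y + t * (y' - y)) ->
  continuity_pt (fun t => phi (x + t * (x' - x)) (y + t * (y' - y))) t.
Proof.
intros H. apply continuity_pt_filterlim.
refine (continuous_comp_2 (fun t => x + t * (x' - x)) (fun t => y + t * (y' - y)) phi t _ _ H);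
  apply (ex_derive_continuous (K := R_AbsRing) (V := R_NormedModule)); auto_derive; trivial.
Qed.

Lemma disc_convex x y x' y' t : x ^ 2 + y ^ 2 <= 1 -> x' ^ 2 + y' ^ 2 <= 1 -> 0 <= t <= 1 ->
  (x + t * (x' - x)) ^ 2 + (y + t * (y' - y)) ^ 2 <= 1.
Proof.
intros H H' Ht.
replace ((x + t * (x' - x)) ^ 2 + (y + t * (y' - y)) ^ 2)
  with ((1 - t) * (x ^ 2 + y ^ 2) + t * (x' ^ 2 + y' ^ 2) - t * (1 - t) * ((x - x') ^ 2 + (y - y') ^ 2)) by ring.
assert (0 <= t * (1 - t) * ((x - x') ^ 2 + (y - y') ^ 2)).
{ apply Rmult_le_pos; [nra|]. assert (H1 := pow2_ge_0 (x - x')). assert (H2 := pow2_ge_0 (y - y')). lra. }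
nra.
Qed.

(** The cosine controls angle differences only modulo [2 * PI]. A difference above [PI] is excluded
    by connectedness: along the segment joining the two points it would pass through [PI], where the
    cosine is [-1 < cos d]. Hence all differences are at most [d], and [m] is the supremum of the
    angles lowered by [d / 2]. *)
Lemma angle_spread (phi : R -> R -> R) (d : R) : 0 < d < PI ->
  (forall x y, x ^ 2 + y ^ 2 <= 1 -> cont2 phi x y) ->
  (forall x y, x ^ 2 + y ^ 2 <= 1 -> - PI < phi x y < PI) ->
  (forall x y x' y', x ^ 2 + y ^ 2 <= 1 -> x' ^ 2 + y' ^ 2 <= 1 -> cos d <= cos (phi x' y' - phi x y)) ->
  exists m, forall x y, x ^ 2 + y ^ 2 <= 1 -> Rabs (phi x y - m) <= d / 2.
Proof.
intros Hd Hc Hb Hcos.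
assert (Hcd : -1 < cos d) by (rewrite <- cos_PI; apply cos_decreasing_1; lra).
assert (Hspread : forall x y x' y', x ^ 2 + y ^ 2 <= 1 -> x' ^ 2 + y' ^ 2 <= 1 -> phi x' y' - phi x y <= d).
{ intros x y x' y' H H'. apply Rnot_lt_le. intros Hlt.
  destruct (Rle_or_lt (phi x' y' - phi x y) PI) as [Hle|Hgt].
  - assert (K := Hcos x y x' y' H H').
    assert (cos (phi x' y' - phi x y) < cos d) by (apply cos_decreasing_1; lra). lra.
  - destruct (Ranalysis5.IVT_interv (fun t => phi (x + t * (x' - x)) (y + t * (y' - y)) - phi x y - PI) 0 1) as (t & Ht & Hz).
    + intros t Ht. apply continuity_pt_minus; [apply continuity_pt_minus|];
        try (apply continuity_pt_const; intros ? ?; reflexivity).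
      apply continuous_segment, Hc, disc_convex; assumption.
    + lra.
    + rewrite !Rmult_0_l, !Rplus_0_r. lra.
    + replace (x + 1 * (x' - x)) with x' by ring. replace (y + 1 * (y' - y)) with y' by ring. lra.
    + assert (K := Hcos x y _ _ H (disc_convex x y x' y' t H H' Ht)).
      replace (phi (x + t * (x' - x)) (y + t * (y' - y)) - phi x y) with PI in K by lra.
      rewrite cos_PI in K. lra. }
destruct (completeness (fun a => exists x y, x ^ 2 + y ^ 2 <= 1 /\ a = phi x y)) as (s & Hs1 & Hs2).
- exists PI. intros a (x & y & H & ->). apply Rlt_le, Hb, H.
- exists (phi 0 0), 0, 0. split; [lra|reflexivity].
- exists (s - d / 2). intros x y H. apply Rabs_le. split.
  + assert (s <= phi x y + d); [|lra]. apply Hs2. intros a (x' & y' & H' & ->).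
    assert (K := Hspread x y x' y' H H'). lra.
  + assert (phi x y <= s); [|lra]. apply Hs1. exists x, y. split; [assumption|reflexivity].
Qed.

Lemma cont2_norm2 u v x y : cont2 u x y -> cont2 v x y -> cont2 (fun x y => norm2 (u x y) (v x y)) x y.
Proof.
intros Hu Hv. unfold norm2, cont2.
apply (continuous_comp (fun p : R * R => u (fst p) (snd p) ^ 2 + v (fst p) (snd p) ^ 2) sqrt).
- refine (continuous_plus _ _ _ _ _); simpl; refine (continuous_mult _ _ _ _ _); try assumption;
  refine (continuous_mult _ _ _ _ _); try assumption; apply continuous_const.
- apply continuous_sqrt.
Qed.

(* By separation the argument of [u + iv] varies by less than [PI] over the disc, so some projection [h] of [u + iv] is positive and comparable to the modulus. *)
Lemma norm_harnack c : 0 < c <= 1 -> exists K, 1 <= K /\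
  forall u v rho, 0 <= rho -> weakly_harmonic u -> weakly_harmonic v -> separated u v rho c ->
  (forall x y, x ^ 2 + y ^ 2 <= 1 -> rho < norm2 (u x y) (v x y)) ->
  forall x y, x ^ 2 + y ^ 2 <= 1 / 4 -> norm2 (u 0 0) (v 0 0) <= K * norm2 (u x y) (v x y).
Proof.
(* Separation says that the cosine of the angle between two large values is at least
   [- (1 - c) = cos d]. *)
intros Hc. set (d := acos (c - 1)).
assert (Hcosd : cos d = c - 1) by (apply cos_acos; lra).
assert (HPI := PI_RGT_0).
assert (Hd : 0 < d < PI).
{ assert (Hb := acos_bound (c - 1)). fold d in Hb.
  assert (d <> 0) by (intros E; rewrite E, cos_0 in Hcosd; lra).
  assert (d <> PI) by (intros E; rewrite E, cos_PI in Hcosd; lra). lra. }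
assert (Hk : 0 < cos (d / 2)) by (apply cos_gt_0; lra).
set (k := cos (d / 2)) in *.
assert (Hk1 : k <= 1) by apply COS_bound.
exists (3 / k). split; [apply (proj1 (Rle_div_r _ _ _ Hk)); lra|].
intros u v rho Hrho Hu Hv Hsep Hbig x0 y0 H0.
set (a := u 0 0). set (b := v 0 0). set (A := norm2 a b).
assert (HA : rho < A) by (apply Hbig; lra).
(* [X + iY] is the map times the conjugate of its value at the centre. Separation from that central
   value keeps it off the closed negative real axis. *)
set (X := fun x y => a * u x y + b * v x y). set (Y := fun x y => a * v x y - b * u x y).
assert (HXY : forall x y, norm2 (X x y) (Y x y) = A * norm2 (u x y) (v x y)) by (intros; apply norm2_dot_cross).
assert (Hpos : forall x y, x ^ 2 + y ^ 2 <= 1 -> 0 < norm2 (X x y) (Y x y) + X x y).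
{ intros x y H. assert (K := Hsep 0 0 x y HA (Hbig x y H)). fold a b A in K.
  rewrite HXY. unfold X. assert (HB := Hbig x y H). assert (0 < A * norm2 (u x y) (v x y)) by nra. nra. }
set (phi := fun x y => 2 * atan (Y x y / (norm2 (X x y) (Y x y) + X x y))).
assert (Hphi : forall x y, x ^ 2 + y ^ 2 <= 1 ->
  X x y = A * norm2 (u x y) (v x y) * cos (phi x y) /\ Y x y = A * norm2 (u x y) (v x y) * sin (phi x y)).
{ intros x y H. rewrite <- HXY. apply half_angle, Hpos, H. }
destruct (angle_spread phi d Hd) as (m & Hm).
- intros x y H.
  assert (CX : cont2 X x y) by apply (weakly_harmonic_lin u v a b Hu Hv).
  assert (CY : cont2 Y x y).
  { apply (continuous_ext (fun p : R * R => a * v (fst p) (snd p) + (- b) * u (fst p) (snd p))).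
    - intros p. unfold Y. simpl. ring.
    - apply (weakly_harmonic_lin v u a (- b) Hv Hu). }
  unfold phi, cont2. refine (continuous_mult _ _ _ _ _); [apply continuous_const|].
  apply (continuous_comp (fun p : R * R => Y (fst p) (snd p) / (norm2 (X (fst p) (snd p)) (Y (fst p) (snd p)) + X (fst p) (snd p))) atan).
  + refine (continuous_mult _ _ _ _ _); [exact CY|].
    apply (continuous_comp (fun p : R * R => norm2 (X (fst p) (snd p)) (Y (fst p) (snd p)) + X (fst p) (snd p)) Rinv).
    * refine (continuous_plus _ _ _ _ _); [apply cont2_norm2; assumption|exact CX].
    * apply continuous_Rinv. assert (K := Hpos x y H). simpl. lra.
  + apply (ex_derive_continuous (K := R_AbsRing) (V := R_NormedModule)). auto_derive. trivial.
- intros x y H. unfold phi. assert (K := atan_bound (Y x y / (norm2 (X x y) (Y x y) + X x y))). lra.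
- intros x y x' y' H H'. rewrite Hcosd, cos_minus.
  assert (K := Hsep x y x' y' (Hbig x y H) (Hbig x' y' H')).
  destruct (Hphi x y H) as [E1 E2]. destruct (Hphi x' y' H') as [E3 E4].
  assert (B1 := Hbig x y H). assert (B2 := Hbig x' y' H').
  set (N := norm2 (u x y) (v x y)) in *. set (N' := norm2 (u x' y') (v x' y')) in *.
  assert (E : A * A * (u x y * u x' y' + v x y * v x' y') = X x y * X x' y' + Y x y * Y x' y').
  { unfold A. rewrite norm2_sqr. unfold X, Y. ring. }
  rewrite E1, E2, E3, E4 in E.
  assert (HNN : 0 < N * N') by nra. assert (HAA : 0 < A * A) by nra.
  apply Rmult_le_reg_l with (A * A * (N * N')); [apply Rmult_lt_0_compat; assumption|].
  replace (A * A * (N * N') * (cos (phi x' y') * cos (phi x y) + sin (phi x' y') * sin (phi x y)))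
    with (A * A * (u x y * u x' y' + v x y * v x' y')) by (rewrite E; ring).
  rewrite Rmult_assoc. apply Rmult_le_compat_l; lra.
- set (h := fun x y => cos m * X x y + sin m * Y x y).
  assert (Hh : weakly_harmonic h).
  { eapply weakly_harmonic_ext; [|apply (weakly_harmonic_lin u v (cos m * a - sin m * b) (cos m * b + sin m * a) Hu Hv)].
    intros x y. unfold h, X, Y. simpl. ring. }
  assert (Eh : forall x y, x ^ 2 + y ^ 2 <= 1 -> A * norm2 (u x y) (v x y) * k <= h x y <= A * norm2 (u x y) (v x y)).
  { intros x y H. unfold h. destruct (Hphi x y H) as [-> ->].
    assert (B1 := Hbig x y H). set (N := norm2 (u x y) (v x y)) in *.
    replace (cos m * (A * N * cos (phi x y)) + sin m * (A * N * sin (phi x y))) with (A * N * cos (phi x y - m))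
      by (rewrite cos_minus; ring).
    assert (HAN : 0 < A * N) by nra.
    assert (Hcosm : k <= cos (phi x y - m)).
    { assert (Hmx := Hm x y H). unfold k.
      destruct (Rle_or_lt 0 (phi x y - m)) as [Hs|Hs].
      - rewrite Rabs_pos_eq in Hmx by assumption. apply cos_decr_1; lra.
      - rewrite Rabs_left in Hmx by assumption. rewrite <- (cos_neg (phi x y - m)). apply cos_decr_1; lra. }
    assert (Hcos1 := COS_bound (phi x y - m)). split; nra. }
  destruct (harnack_disc h x0 y0 Hh) as [HH _].
  + intros t. assert (K := Eh _ _ (circle_in_disc t)).
    assert (B1 := Hbig _ _ (circle_in_disc t)). unfold trace.
    assert (0 <= A * norm2 (u (cos t) (sin t)) (v (cos t) (sin t)) * k); [|lra].
    apply Rmult_le_pos; [|lra]. nra.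
  + exact H0.
  + assert (K0 := Eh 0 0 ltac:(lra)). assert (K1 := Eh x0 y0 ltac:(lra)).
    fold a b A in K0. change (norm2 (u 0 0) (v 0 0)) with A.
    set (N := norm2 (u x0 y0) (v x0 y0)) in *.
    apply Rmult_le_reg_l with (A * k); [nra|].
    replace (A * k * (3 / k * N)) with (3 * (A * N)) by (field; lra). fold A in K0. lra.
Qed.

(** * Bounded range *)

(** Dilation by [r / s] brings the given point to radius [s] without changing the bound [M]; the
    expansion cut after its constant term then has error at most [16 * M * s], with [s] as small as
    desired. *)
Lemma liouville w M : weakly_harmonic w -> (forall x y, Rabs (w x y) <= M) -> forall x y, w x y = w 0 0.
Proof.
intros Hw HM x y. apply cond_eq. intros e He.
assert (HM0 : 0 <= M) by (apply Rle_trans with (2 := HM 0 0); apply Rabs_pos).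
destruct (polar_coordinates x y) as (r & t & Hr & _ & _ & -> & ->).
set (s := Rmin (1 / 2) (e / (32 * (M + 1)))).
assert (Hs : 0 < s <= 1 / 2).
{ split; [|apply Rmin_l]. apply Rmin_pos; [lra|]. apply Rdiv_lt_0_compat; lra. }
assert (Hse : 16 * (M + 1) * s <= e / 2).
{ apply Rle_trans with (16 * (M + 1) * (e / (32 * (M + 1)))); [|right; field; lra].
  apply Rmult_le_compat_l; [lra|apply Rmin_r]. }
set (W := fun x y => w (0 + r / s * x) (0 + r / s * y)).
assert (HW : weakly_harmonic W) by apply (weakly_harmonic_affine w 0 0 (r / s) Hw).
assert (H := harmonic_expansion W M 0 s t HW (fun t => HM _ _) ltac:(lra)).
cbn [sum_f_R0 Nat.add] in H. rewrite pow_O, pow_1, Rmult_1_l, circle_term_zero in H by exact HW. unfold W in H.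
replace (0 + r / s * (s * cos t)) with (r * cos t) in H by (field; lra).
replace (0 + r / s * (s * sin t)) with (r * sin t) in H by (field; lra).
replace (0 + r / s * 0) with 0 in H by ring.
assert (Hf := half_disc_factor s ltac:(lra)).
apply Rle_lt_trans with (1 := H).
apply Rle_lt_trans with (M * 16 * s); [|nra].
apply Rmult_le_compat_r; [lra|]. apply Rmult_le_compat_l; [lra|apply Hf].
Qed.

(** * Compactness of the circle *)

Lemma is_lim_seq_inv_INR : is_lim_seq (fun n => / (INR n + 1)) 0.
Proof.
replace (Finite 0) with (Rbar_inv p_infty) by reflexivity.
apply is_lim_seq_inv; [|discriminate].
apply (is_lim_seq_plus _ _ p_infty 1); [apply is_lim_seq_INR|apply is_lim_seq_const|reflexivity].
Qed.

Lemma is_lim_seq_squeeze_0 (x s : nat -> R) : (forall n, Rabs (x n) <= s n) -> is_lim_seq s 0 -> is_lim_seq x 0.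
Proof.
intros H Hs. apply is_lim_seq_abs_0. apply (is_lim_seq_le_le (fun _ => 0) _ s).
- intros n. split; [apply Rabs_pos|apply H].
- apply is_lim_seq_const.
- exact Hs.
Qed.

Lemma norm2_polar r t : 0 <= r -> norm2 (r * cos t) (r * sin t) = r.
Proof.
intros Hr. unfold norm2. replace ((r * cos t) ^ 2 + (r * sin t) ^ 2) with (Rsqr r).
- apply sqrt_Rsqr, Hr.
- assert (H := sin2_cos2 t). unfold Rsqr in *. replace (r * r) with (r * r * (sin t * sin t + cos t * cos t)) by (rewrite H; ring). ring.
Qed.

Lemma subsequential_limit (t : nat -> R) (a b : R) : (forall n, a <= t n <= b) ->
  exists l, forall m, exists n, (m <= n)%nat /\ Rabs (t n - l) <= / (INR m + 1).
Proof.
intros Ht. destruct (Bolzano_Weierstrass t _ (compact_P3 a b) Ht) as [l Hl].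
exists l. intros m.
assert (Hm : 0 < / (INR m + 1)) by (apply Rinv_0_lt_compat; assert (H := pos_INR m); lra).
destruct (Hl (disc l (mkposreal _ Hm)) m) as (n & Hn & Hd).
- exists (mkposreal _ Hm). intros z Hz. exact Hz.
- exists n. split; [assumption|]. left. exact Hd.
Qed.

(** Failure of separation for [rho = n + 1] and [c = 1 / (n + 1)] yields, for every [n], two values
    of modulus above [n + 1] in nearly opposite directions. Along indices where the first direction
    converges, the second converges to its opposite; the inverse moduli are the required null
    sequences. *)
Lemma separation_of_range u v :
  ~ (exists zeta : R * R, on_unit_circle zeta /\ asymptotic_direction (range_f u v) zeta /\
        asymptotic_direction (range_f u v) (- fst zeta, - snd zeta)) ->
  exists rho c, 0 < rho /\ 0 < c <= 1 /\ separated u v rho c.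
Proof.
intros Hno. apply NNPP. intros Hsep. apply Hno.
assert (Hinv : forall n, 0 < / (INR n + 1) <= 1).
{ intros n. assert (H := pos_INR n). split; [apply Rinv_0_lt_compat; lra|].
  rewrite <- Rinv_1. apply Rinv_le_contravar; lra. }
(* One value is kept in polar form, with its modulus in the first and its angle in the third
   component of [z], so that compactness applies to the angle; [q] is the other value. *)
assert (Hn : forall n, exists z : R * R * R, exists q : R * R,
  range_f u v (fst (fst z) * cos (snd z), fst (fst z) * sin (snd z)) /\ range_f u v q /\
  INR n + 1 < fst (fst z) /\ - PI <= snd z <= PI /\ INR n + 1 < norm2 (fst q) (snd q) /\
  cos (snd z) * fst q + sin (snd z) * snd q <= - (1 - / (INR n + 1)) * norm2 (fst q) (snd q)).
{ intros n. apply NNPP. intros Hc. apply Hsep.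
  assert (H := pos_INR n). exists (INR n + 1), (/ (INR n + 1)).
  split; [lra|]. split; [apply Hinv|].
  intros x y x' y' H1 H2. apply Rnot_lt_le. intros Hlt. apply Hc.
  destruct (polar_coordinates (u x y) (v x y)) as (r & t & Hr & _ & Ht & Hx & Hy).
  exists (r, 0, t), (u x' y', v x' y'). simpl.
  rewrite Hx, Hy, norm2_polar in H1, Hlt by assumption.
  split; [exists x, y; rewrite <- Hx, <- Hy; reflexivity|].
  split; [exists x', y'; reflexivity|].
  split; [assumption|]. split; [assumption|]. split; [assumption|].
  apply Rmult_le_reg_l with r; [lra|]. lra. }
apply functional_choice in Hn. destruct Hn as (z & Hn). apply functional_choice in Hn. destruct Hn as (q & Hn).
set (t := fun n => snd (z n)). set (r := fun n => fst (fst (z n))).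
destruct (subsequential_limit t (- PI) PI) as (l & Hl); [intros n; apply Hn|].
apply functional_choice in Hl. destruct Hl as (k & Hk).
assert (Hmono : forall n, / (INR (k n) + 1) <= / (INR n + 1)).
{ intros n. assert (H := pos_INR n). apply Rinv_le_contravar; [lra|].
  apply Rplus_le_compat_r, le_INR, Hk. }
assert (Ht : is_lim_seq (fun n => t (k n)) l).
{ apply is_lim_seq_ext with (fun n => (t (k n) - l) + l); [intros; ring|].
  replace (Finite l) with (Rbar_plus 0 l) by (simpl; f_equal; ring).
  apply is_lim_seq_plus'; [|apply is_lim_seq_const].
  apply is_lim_seq_squeeze_0 with (2 := is_lim_seq_inv_INR). intros n. apply Hk. }
assert (Hcos : is_lim_seq (fun n => cos (t (k n))) (cos l)) by (apply is_lim_seq_continuous; [apply continuity_cos|exact Ht]).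
assert (Hsin : is_lim_seq (fun n => sin (t (k n))) (sin l)) by (apply is_lim_seq_continuous; [apply continuity_sin|exact Ht]).
assert (Heps : forall f : nat -> R, (forall n, INR n + 1 < f n) -> is_lim_seq (fun n => / f (k n)) 0).
{ intros f Hf. apply is_lim_seq_squeeze_0 with (2 := is_lim_seq_inv_INR). intros n.
  assert (H := pos_INR (k n)). assert (Hfn := Hf (k n)).
  rewrite Rabs_pos_eq by (left; apply Rinv_0_lt_compat; lra).
  apply Rle_trans with (2 := Hmono n). apply Rinv_le_contravar; lra. }
set (N := fun n => norm2 (fst (q n)) (snd (q n))).
assert (Hsq : is_lim_seq (fun n => sqrt (2 * / (INR n + 1))) 0).
{ rewrite <- sqrt_0. apply (is_lim_seq_continuous sqrt); [apply continuity_pt_sqrt; lra|].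
  replace (Finite 0) with (Rbar_mult 2 0) by (simpl; f_equal; ring).
  apply is_lim_seq_scal_l, is_lim_seq_inv_INR. }
(* For unit vectors the squared norm of the sum is 2 plus twice the inner product, here at most
   [2 / (k n + 1)]. *)
assert (Hclose : forall n, Rabs (/ N (k n) * fst (q (k n)) + cos (t (k n))) <= sqrt (2 * / (INR n + 1)) /\
   Rabs (/ N (k n) * snd (q (k n)) + sin (t (k n))) <= sqrt (2 * / (INR n + 1))).
{ intros n. destruct (Hn (k n)) as (_ & _ & _ & _ & H5 & H6). fold (t (k n)) in H6. fold (N (k n)) in H5, H6.
  assert (H := pos_INR (k n)).
  assert (HN := norm2_sqr (fst (q (k n))) (snd (q (k n)))). fold (N (k n)) in HN.
  set (a := / N (k n) * fst (q (k n)) + cos (t (k n))). set (b := / N (k n) * snd (q (k n)) + sin (t (k n))).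
  assert (Hab : a ^ 2 + b ^ 2 <= 2 * / (INR n + 1)).
  { assert (H1 := sin2_cos2 (t (k n))). unfold Rsqr in H1.
    replace (a ^ 2 + b ^ 2) with (/ N (k n) * / N (k n) * (fst (q (k n)) ^ 2 + snd (q (k n)) ^ 2)
      + 2 * / N (k n) * (cos (t (k n)) * fst (q (k n)) + sin (t (k n)) * snd (q (k n)))
      + (sin (t (k n)) * sin (t (k n)) + cos (t (k n)) * cos (t (k n)))) by (unfold a, b; ring).
    rewrite H1, <- HN. replace (/ N (k n) * / N (k n) * (N (k n) * N (k n))) with 1 by (field; lra).
    assert (H7 : / N (k n) * (cos (t (k n)) * fst (q (k n)) + sin (t (k n)) * snd (q (k n)))
       <= / N (k n) * (- (1 - / (INR (k n) + 1)) * N (k n))).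
    { apply Rmult_le_compat_l; [left; apply Rinv_0_lt_compat; lra|exact H6]. }
    replace (/ N (k n) * (- (1 - / (INR (k n) + 1)) * N (k n))) with (- (1 - / (INR (k n) + 1))) in H7 by (field; lra).
    assert (H8 := Hmono n). lra. }
  assert (HA := Rabs_le_norm2 a b). unfold norm2 in HA.
  assert (HS := sqrt_le_1_alt _ _ Hab). split; lra. }
exists (cos l, sin l). split; [|split].
- assert (H := sin2_cos2 l). unfold on_unit_circle. unfold Rsqr in H. simpl. lra.
- exists (fun n => (r (k n) * cos (t (k n)), r (k n) * sin (t (k n)))), (fun n => / r (k n)).
  assert (Hr : forall n, INR n + 1 < r n) by (intros n; apply Hn).
  assert (Hr0 : forall n, 0 < r n) by (intros n; assert (H := Hr n); assert (H0 := pos_INR n); lra).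
  split; [intros n; apply Hn|]. split; [intros n; apply Rinv_0_lt_compat, Hr0|].
  split; [apply Heps, Hr|]. simpl. split.
  + apply is_lim_seq_ext with (2 := Hcos). intros n. field. assert (H := Hr0 (k n)). lra.
  + apply is_lim_seq_ext with (2 := Hsin). intros n. field. assert (H := Hr0 (k n)). lra.
- exists (fun n => q (k n)), (fun n => / N (k n)).
  assert (HN : forall n, INR n + 1 < N n) by (intros n; apply Hn).
  split; [intros n; apply Hn|].
  split; [intros n; apply Rinv_0_lt_compat; assert (H := HN (k n)); assert (H0 := pos_INR (k n)); lra|].
  split; [apply Heps, HN|]. simpl. split.
  + apply is_lim_seq_ext with (fun n => (/ N (k n) * fst (q (k n)) + cos (t (k n))) - cos (t (k n))); [intros; ring|].
    replace (- cos l) with (0 - cos l) by ring. apply is_lim_seq_minus'; [|exact Hcos].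
    apply is_lim_seq_squeeze_0 with (2 := Hsq). apply Hclose.
  + apply is_lim_seq_ext with (fun n => (/ N (k n) * snd (q (k n)) + sin (t (k n))) - sin (t (k n))); [intros; ring|].
    replace (- sin l) with (0 - sin l) by ring. apply is_lim_seq_minus'; [|exact Hsin].
    apply is_lim_seq_squeeze_0 with (2 := Hsq). apply Hclose.
Qed.

(** * Selection of a disc and rescaling *)

Lemma norm2_scal s a b : 0 <= s -> norm2 (s * a) (s * b) = s * norm2 a b.
Proof.
intros Hs. unfold norm2. replace ((s * a) ^ 2 + (s * b) ^ 2) with (Rsqr s * (a ^ 2 + b ^ 2)) by (unfold Rsqr; ring).
rewrite sqrt_mult by (try apply Rle_0_sqr; nra). rewrite sqrt_Rsqr by assumption. reflexivity.
Qed.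

Lemma norm2_le_sqr a b m : norm2 a b <= m -> a ^ 2 + b ^ 2 <= m ^ 2.
Proof. intros H. assert (H1 := norm2_sqr a b). assert (H2 := norm2_pos a b). nra. Qed.

Lemma bounded_large_disc u v r : 0 < r -> (forall x y, cont2 u x y) -> (forall x y, cont2 v x y) ->
  exists M, forall x y, norm2 x y <= r -> norm2 (u x y) (v x y) <= M.
Proof.
intros Hr Hu Hv.
destruct (bounded_disc (fun x y => norm2 (u (0 + r * x) (0 + r * y)) (v (0 + r * x) (0 + r * y)))) as [M HM].
- intros x y. apply (cont2_norm2 (fun x y => u (0 + r * x) (0 + r * y)) (fun x y => v (0 + r * x) (0 + r * y)));
  [apply (cont2_comp u (fun x y => 0 + r * x) (fun x y => 0 + r * y)); [apply Hu| |]
  |apply (cont2_comp v (fun x y => 0 + r * x) (fun x y => 0 + r * y)); [apply Hv| |]];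
  unfold cont2; simpl; refine (continuous_plus _ _ _ _ _); try apply continuous_const;
  refine (continuous_mult _ _ _ _ _); try apply continuous_const; try apply continuous_fst; apply continuous_snd.
- exists M. intros x y H.
  assert (K : (x / r) ^ 2 + (y / r) ^ 2 <= 1).
  { replace ((x / r) ^ 2 + (y / r) ^ 2) with ((x ^ 2 + y ^ 2) / r ^ 2) by (field; lra).
    apply (proj2 (Rle_div_l _ _ _ (pow_lt r 2 Hr))). rewrite Rmult_1_l. apply norm2_le_sqr, H. }
  assert (L := HM _ _ K). cbv beta in L.
  replace (0 + r * (x / r)) with x in L by (field; lra). replace (0 + r * (y / r)) with y in L by (field; lra).
  eapply Rle_trans; [apply Rle_abs|exact L].
Qed.

Lemma norm2_dist a b x y : norm2 x y <= norm2 a b + norm2 (x - a) (y - b).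
Proof.
assert (H := norm2_triangle a b (x - a) (y - b)).
replace (a + (x - a)) with x in H by ring. replace (b + (y - b)) with y in H by ring. exact H.
Qed.

(* Maximising the modulus over discs [D(z, (r0 - |z|) / 8)] whose centre satisfies [|u + iv| <= rho], one finds a disc on which the modulus is large, although it is small at the centre and grows only by a fixed factor on the concentric disc of twice the radius. *)
Lemma doubling_disc u v rho K s : weakly_harmonic u -> weakly_harmonic v -> 1 <= K -> 0 <= s ->
  (forall a b d, 0 < d -> (forall x y, norm2 (x - a) (y - b) <= d -> rho < norm2 (u x y) (v x y)) ->
     forall x y, norm2 (x - a) (y - b) <= d / 2 -> norm2 (u a b) (v a b) <= K * norm2 (u x y) (v x y)) ->
  norm2 (u 0 0) (v 0 0) <= rho -> (exists x y, s < norm2 (u x y) (v x y)) ->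
  exists a b d g, 0 < d /\ s < g /\ norm2 (u a b) (v a b) <= rho /\
    (exists x y, norm2 (x - a) (y - b) <= d /\ g / 2 < norm2 (u x y) (v x y)) /\
    (forall x y, norm2 (x - a) (y - b) <= 2 * d -> norm2 (u x y) (v x y) <= K ^ 16 * g).
Proof.
intros Hu Hv HK Hs Hharnack H0 (xs & ys & Hlarge).
set (f := fun x y => norm2 (u x y) (v x y)).
(* Large enough for the disc of radius [r0 / 8] about the origin to contain [(xs, ys)], so that the
   supremum [g] exceeds [s]. *)
set (r0 := 8 * norm2 xs ys + 8).
assert (Hr0 : 0 < r0) by (unfold r0; assert (H := norm2_pos xs ys); lra).
destruct (bounded_large_disc u v r0 Hr0 (proj1 Hu) (proj1 Hv)) as [M HM].
set (S := fun m => exists a b x y, f a b <= rho /\ norm2 a b < r0 /\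
  norm2 (x - a) (y - b) <= (r0 - norm2 a b) / 8 /\ m = f x y).
assert (Hzero : norm2 0 0 = 0) by (unfold norm2; replace (0 ^ 2 + 0 ^ 2) with 0 by ring; apply sqrt_0).
assert (HSs : S (f xs ys)).
{ exists 0, 0, xs, ys. rewrite Hzero, !Rminus_0_r. split; [exact H0|]. split; [lra|].
  split; [unfold r0; lra|reflexivity]. }
destruct (completeness S) as (g & Hg1 & Hg2).
- exists M. intros m (a & b & x & y & _ & Hab & Hxy & ->). apply HM.
  assert (H := norm2_dist a b x y). lra.
- eexists; exact HSs.
- assert (Hsg : s < g) by (apply Rlt_le_trans with (1 := Hlarge); apply Hg1, HSs).
  assert (Hex : exists m, S m /\ g / 2 < m).
  { apply NNPP. intros Hc. assert (g <= g / 2); [|lra]. apply Hg2. intros m Hm.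
    apply Rnot_lt_le. intros Hlt. apply Hc. exists m. split; assumption. }
  destruct Hex as (m & (a & b & x1 & y1 & Hab & Hab0 & Hxy & ->) & Hm).
  set (d := (r0 - norm2 a b) / 8) in *.
  assert (Hd : 0 < d) by (unfold d; lra).
  exists a, b, d, g. split; [assumption|]. split; [assumption|]. split; [exact Hab|].
  split; [exists x1, y1; split; [exact Hxy|exact Hm]|].
  intros x y Hp.
  (* Sixteen steps of length at most [d / 8] lead from the centre to any point of the doubled disc.
     At each point [(p, q)], either some point within [d / 4] has modulus at most [rho], and its own
     admissible disc, of radius at least [23 * d / 32], contains [(p, q)], so that [g] is a bound;
     or Harnack on the disc of radius [d / 4] about [(p, q)] compares with the previous point at the
     cost of a factor [K]. *)
  assert (Hchain : forall i, (i <= 16)%nat ->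
    f (a + INR i / 16 * (x - a)) (b + INR i / 16 * (y - b)) <= K ^ i * g).
  { induction i as [|i IH]; intros Hi.
    - simpl. replace (a + 0 / 16 * (x - a)) with a by field. replace (b + 0 / 16 * (y - b)) with b by field.
      rewrite Rmult_1_l. apply Hg1. exists a, b, a, b. rewrite !Rminus_diag, Hzero.
      split; [exact Hab|]. split; [assumption|]. split; [lra|reflexivity].
    - assert (Hi16 : 0 <= INR (Datatypes.S i) / 16 <= 1).
      { assert (H := le_INR _ _ Hi). assert (H' := pos_INR (Datatypes.S i)).
        replace (INR 16) with 16 in H by (simpl; ring). lra. }
      set (c := INR (Datatypes.S i) / 16) in *.
      set (p := a + c * (x - a)). set (q := b + c * (y - b)).
      assert (Hpq : norm2 (p - a) (q - b) <= 2 * d).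
      { unfold p, q. replace (a + c * (x - a) - a) with (c * (x - a)) by ring.
        replace (b + c * (y - b) - b) with (c * (y - b)) by ring.
        rewrite norm2_scal by lra. assert (H := norm2_pos (x - a) (y - b)). nra. }
      assert (HKi : 1 <= K ^ Datatypes.S i) by (apply pow_R1_Rle; assumption).
      destruct (classic (exists a' b', norm2 (a' - p) (b' - q) <= d / 4 /\ f a' b' <= rho))
        as [(a' & b' & Ha' & Hf')|Hno].
      + apply Rle_trans with g; [|nra]. apply Hg1. exists a', b', p, q.
        assert (H1 := norm2_dist a b p q). assert (H2 := norm2_dist p q a' b').
        split; [assumption|]. split; [unfold d in *; lra|]. split; [|reflexivity].
        replace (p - a') with (- (a' - p)) by ring. replace (q - b') with (- (b' - q)) by ring.
        rewrite norm2_opp. unfold d in *. lra.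
      + assert (IH' := IH ltac:(lia)).
        apply Rle_trans with (K * f (a + INR i / 16 * (x - a)) (b + INR i / 16 * (y - b))).
        * apply (Hharnack p q (d / 4)); [lra| |].
          -- intros x' y' Hxy'. apply Rnot_le_lt. intros Hle. apply Hno. exists x', y'. split; assumption.
          -- replace (a + INR i / 16 * (x - a) - p) with (- (1 / 16 * (x - a))) by (unfold p, c; rewrite S_INR; field).
             replace (b + INR i / 16 * (y - b) - q) with (- (1 / 16 * (y - b))) by (unfold q, c; rewrite S_INR; field).
             rewrite norm2_opp, norm2_scal by lra. lra.
        * simpl pow. rewrite Rmult_assoc. apply Rmult_le_compat_l; [lra|exact IH']. }
  assert (H := Hchain 16%nat ltac:(lia)).
  replace (INR 16) with 16 in H by (simpl; ring).
  replace (a + 16 / 16 * (x - a)) with x in H by field. replace (b + 16 / 16 * (y - b)) with y in H by field.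
  exact H.
Qed.

Lemma norm_harnack_disc c : 0 < c <= 1 -> exists K, 1 <= K /\
  forall u v rho, 0 <= rho -> weakly_harmonic u -> weakly_harmonic v -> separated u v rho c ->
  forall a b d, 0 < d -> (forall x y, norm2 (x - a) (y - b) <= d -> rho < norm2 (u x y) (v x y)) ->
  forall x y, norm2 (x - a) (y - b) <= d / 2 -> norm2 (u a b) (v a b) <= K * norm2 (u x y) (v x y).
Proof.
intros Hc. destruct (norm_harnack c Hc) as (K & HK & H). exists K. split; [assumption|].
intros u v rho Hrho Hu Hv Hsep a b d Hd Hbig x y Hxy.
assert (L := H (fun x y => u (a + d * x) (b + d * y)) (fun x y => v (a + d * x) (b + d * y)) rho Hrho
  (weakly_harmonic_affine u a b d Hu) (weakly_harmonic_affine v a b d Hv)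
  (fun x y x' y' => Hsep _ _ _ _)).
cbv beta in L.
assert (Hin : forall x' y', x' ^ 2 + y' ^ 2 <= 1 -> rho < norm2 (u (a + d * x') (b + d * y')) (v (a + d * x') (b + d * y'))).
{ intros x' y' H'. apply Hbig.
  replace (a + d * x' - a) with (d * x') by ring. replace (b + d * y' - b) with (d * y') by ring.
  rewrite norm2_scal by lra. assert (norm2 x' y' <= 1) by (apply norm2_le; lra). nra. }
assert (L1 := L Hin ((x - a) / d) ((y - b) / d)).
replace (a + d * 0) with a in L1 by ring. replace (b + d * 0) with b in L1 by ring.
replace (a + d * ((x - a) / d)) with x in L1 by (field; lra). replace (b + d * ((y - b) / d)) with y in L1 by (field; lra).
apply L1.
replace (((x - a) / d) ^ 2 + ((y - b) / d) ^ 2) with (((x - a) ^ 2 + (y - b) ^ 2) / d ^ 2) by (field; lra).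
apply (proj2 (Rle_div_l _ _ _ (pow_lt d 2 Hd))). replace (1 / 4 * d ^ 2) with ((d / 2) ^ 2) by field.
apply norm2_le_sqr, Hxy.
Qed.

Lemma separated_bounded u v rho c : weakly_harmonic u -> weakly_harmonic v -> 0 < c <= 1 ->
  separated u v rho c -> exists M, forall x y, norm2 (u x y) (v x y) <= M.
Proof.
intros Hu Hv Hc Hsep0. apply NNPP. intros Hunb.
(* Raising the threshold preserves separation and makes the origin an admissible centre for the
   selection. *)
set (rho0 := Rmax rho (norm2 (u 0 0) (v 0 0))).
assert (Hrho0 : 0 <= rho0) by (eapply Rle_trans; [apply norm2_pos|apply Rmax_r]).
assert (Hsep : separated u v rho0 c).
{ intros x y x' y' H1 H2. assert (H := Rmax_l rho (norm2 (u 0 0) (v 0 0))). fold rho0 in H. apply Hsep0; lra. }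
destruct (norm_harnack_disc c Hc) as (K & HK & Hharnack).
assert (HK16 : 0 < K ^ 16) by (apply pow_lt; lra).
destruct (small_on_half_disc (K ^ 16) c HK16 Hc) as (e & He & Hsmall).
(* From [g > rho0 / e], division by [g] brings both the threshold and the modulus at the centre
   below [e]. *)
destruct (doubling_disc u v rho0 K (rho0 / e) Hu Hv HK) as (a & b & d & g & Hd & Hg & Hab & (x1 & y1 & Hxy & Hxyg) & Hbound).
- apply Rmult_le_pos; [assumption|]. left. apply Rinv_0_lt_compat, He.
- apply Hharnack; assumption.
- apply Rmax_r.
- apply NNPP. intros H. apply Hunb. exists (rho0 / e). intros x y. apply Rnot_lt_le. intros Hlt.
  apply H. exists x, y. exact Hlt.
- assert (Hg0 : 0 < g).
  { apply Rle_lt_trans with (2 := Hg). apply Rmult_le_pos; [assumption|]. left. apply Rinv_0_lt_compat, He. }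
  assert (Hge : rho0 < e * g).
  { apply Rmult_lt_compat_l with (r := e) in Hg; [|assumption].
    replace (e * (rho0 / e)) with rho0 in Hg by (field; lra). exact Hg. }
  assert (Hig : 0 < / g) by (apply Rinv_0_lt_compat, Hg0).
  (* The unit disc corresponds to the doubled disc, where the bound [K ^ 16 * g] holds, and the half
     disc to the selected one, which contains [(x1, y1)]. *)
  set (scaled := fun (w : R -> R -> R) x y => / g * w (a + 2 * d * x) (b + 2 * d * y)).
  assert (Hsc : forall w, weakly_harmonic w -> weakly_harmonic (scaled w)).
  { intros w Hw. assert (H := weakly_harmonic_affine w a b (2 * d) Hw).
    eapply weakly_harmonic_ext; [|apply (weakly_harmonic_lin _ _ (/ g) 0 H H)].
    intros x y. unfold scaled. simpl. ring. }
  assert (Hnorm : forall x y, norm2 (scaled u x y) (scaled v x y)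
    = / g * norm2 (u (a + 2 * d * x) (b + 2 * d * y)) (v (a + 2 * d * x) (b + 2 * d * y))).
  { intros x y. apply norm2_scal. lra. }
  assert (Hcirc : forall t, norm2 (scaled u (cos t) (sin t)) (scaled v (cos t) (sin t)) <= K ^ 16).
  { intros t. rewrite Hnorm. replace (K ^ 16) with (/ g * (K ^ 16 * g)) by (field; lra).
    apply Rmult_le_compat_l; [lra|]. apply Hbound.
    replace (a + 2 * d * cos t - a) with (2 * d * cos t) by ring. replace (b + 2 * d * sin t - b) with (2 * d * sin t) by ring.
    rewrite norm2_polar; lra. }
  assert (L := Hsmall (scaled u) (scaled v) (Hsc u Hu) (Hsc v Hv)
    (fun t => Rle_trans _ _ _ (proj1 (Rabs_le_norm2 _ _)) (Hcirc t))
    (fun t => Rle_trans _ _ _ (proj2 (Rabs_le_norm2 _ _)) (Hcirc t))).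
  assert (Lc : norm2 (scaled u 0 0) (scaled v 0 0) <= e).
  { rewrite Hnorm, !Rmult_0_r, !Rplus_0_r. replace e with (/ g * (e * g)) by (field; lra).
    apply Rmult_le_compat_l; lra. }
  assert (Ls : separated (scaled u) (scaled v) e c).
  { intros x y x' y' H1 H2. rewrite Hnorm in H1, H2. rewrite !Hnorm.
    assert (Hlift : forall N, e < / g * N -> rho0 < N).
    { intros N HN. apply Rmult_lt_compat_l with (r := g) in HN; [|assumption].
      replace (g * (/ g * N)) with N in HN by (field; lra). lra. }
    assert (H := Hsep _ _ _ _ (Hlift _ H1) (Hlift _ H2)).
    apply Rmult_le_compat_l with (r := / g * / g) in H; [|apply Rlt_le, Rmult_lt_0_compat; assumption].
    unfold scaled. lra. }
  assert (Lf := L Lc Ls ((x1 - a) / (2 * d)) ((y1 - b) / (2 * d))).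
  rewrite Hnorm in Lf.
  replace (a + 2 * d * ((x1 - a) / (2 * d))) with x1 in Lf by (field; lra).
  replace (b + 2 * d * ((y1 - b) / (2 * d))) with y1 in Lf by (field; lra).
  assert (Hin : ((x1 - a) / (2 * d)) ^ 2 + ((y1 - b) / (2 * d)) ^ 2 <= 1 / 4).
  { replace (((x1 - a) / (2 * d)) ^ 2 + ((y1 - b) / (2 * d)) ^ 2) with (1 / 4 * (((x1 - a) ^ 2 + (y1 - b) ^ 2) / d ^ 2)) by (field; lra).
    assert (((x1 - a) ^ 2 + (y1 - b) ^ 2) / d ^ 2 <= 1); [|lra].
    apply (proj2 (Rle_div_l _ _ _ (pow_lt d 2 Hd))). rewrite Rmult_1_l. apply norm2_le_sqr, Hxy. }
  apply Lf in Hin. apply Rmult_lt_compat_l with (r := g) in Hin; [|assumption].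
  replace (g * (/ g * norm2 (u x1 y1) (v x1 y1))) with (norm2 (u x1 y1) (v x1 y1)) in Hin by (field; lra). lra.
Qed.

Theorem theorem1 (u v : R -> R -> R) :
  harmonic u -> harmonic v ->
  ~ (exists zeta : R * R,
        on_unit_circle zeta /\
        asymptotic_direction (range_f u v) zeta /\
        asymptotic_direction (range_f u v) (- fst zeta, - snd zeta)) ->
  exists c : R * R, forall x y : R, (u x y, v x y) = c.
Proof.
intros Hu Hv Hno. apply harmonic_weakly in Hu. apply harmonic_weakly in Hv.
destruct (separation_of_range u v Hno) as (rho & c & _ & Hc & Hsep).
destruct (separated_bounded u v rho c Hu Hv Hc Hsep) as [M HM].
exists (u 0 0, v 0 0). intros x y.
rewrite (liouville u M Hu (fun x y => Rle_trans _ _ _ (proj1 (Rabs_le_norm2 _ (v x y))) (HM x y)) x y).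
rewrite (liouville v M Hv (fun x y => Rle_trans _ _ _ (proj2 (Rabs_le_norm2 (u x y) _)) (HM x y)) x y).
reflexivity.
Qed.
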